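(* Let $d \geq 1$ and $1/(d+1) < \alpha < 1/d$. Then with high probability a complex $\widetilde Z \sim \widetilde Z(2n, n^{-\alpha})$, with its free involution $\iota\colon \widetilde Z \to \widetilde Z$, satisfies: for every continuous map $f\colon |\widetilde Z| \to \mathbb{R}^{d+1}$ there is a point $x \in |\widetilde Z|$ with $f(x) = f(\iota(x))$.
   Context: For a flag complex $K$ on vertex set $V$ (i.e., the clique complex of its 1-skeleton), the separated deleted join of $K$ is the simplicial complex on vertex set $V \times \{-1,+1\}$ whose faces are the sets $(\sigma \times \{-1\}) \cup (\tau \times \{+1\})$ where $\sigma, \tau$ are faces of $K$ (possibly empty) with $\sigma \cap \tau = \emptyset$ and no vertex of $\sigma$ is joined by an edge of $K$ to any vertex of $\tau$. It carries the simplicial involution $\iota$ given by $\iota(v,-1) = (v,+1)$, $\iota(v,+1) = (v,-1)$, which is fixed-point free on the geometric realization. For a finite simple graph $G$, let $\overline G$ denote its flag (clique) complex and $\widetilde Z(G)$ the separated deleted join of $\overline G$. $\widetilde Z(2n,p)$ denotes the distribution of $\widetilde Z(G)$ for $G \sim G(n,p)$, the Erdős–Rényi random graph on $[n]$ with each edge independently present with probability $p$. ''With high probability'' means with probability tending to $1$ as $n\to\infty$. *)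

(* Defs.v *)
From HB Require Import structures.
From mathcomp Require Import all_boot all_order all_algebra.
From mathcomp Require Import all_classical all_reals all_analysis.
Set Implicit Arguments. Unset Strict Implicit. Unset Printing Implicit Defensive.
Import Order.TTheory GRing.Theory Num.Theory.
Import numFieldNormedType.Exports.
Local Open Scope classical_set_scope.
Local Open Scope ring_scope.

Definition is_graph n (E : {set {set 'I_n}}) : bool :=
  E \subset ([set e : {set 'I_n} | #|e| == 2%N])%SET.

Definition adj n (E : {set {set 'I_n}}) (u v : 'I_n) : bool := ([set u; v] : {set 'I_n})%SET \in E.

(* faces of the flag complex: cliques (pairwise adjacent vertex sets, possibly empty) *)
Definition is_clique n (E : {set {set 'I_n}}) (s : {set 'I_n}) : bool :=
  [forall u in s, forall v in s, (u != v) ==> adj E u v].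

(* (s x {-1}) u (t x {+1}) is a face of the separated deleted join *)
Definition sdj_face n (E : {set {set 'I_n}}) (s t : {set 'I_n}) : bool :=
  [&& is_clique E s, is_clique E t, [disjoint s & t]
    & [forall u in s, forall v in t, ~~ adj E u v]].

(* Points of R^(V x {-1,+1}) are 2 x n matrices: row ord0 <-> sign -1,
   row ord_max <-> sign +1, column j <-> vertex j. *)
Definition mx_supp (R : realType) n (x : 'M[R]_(2, n)) (i : 'I_2) : {set 'I_n} :=
  ([set j | x i j != 0])%SET.

Definition sdj_realization (R : realType) n (E : {set {set 'I_n}}) : set 'M[R]_(2, n) :=
  [set x : 'M[R]_(2, n) | (forall i j, 0 <= x i j) /\ \sum_(i < 2) \sum_(j < n) x i j = 1
           /\ sdj_face E (mx_supp x ord0) (mx_supp x ord_max)].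

(* the free involution iota (linear extension of (v,-1) <-> (v,+1)) *)
Definition sdj_inv (R : realType) n (x : 'M[R]_(2, n)) : 'M[R]_(2, n) :=
  \matrix_(i < 2, j < n) x (rev_ord i) j.

Definition has_Z2_coincidence (R : realType) n (E : {set {set 'I_n}}) (d : nat) : Prop :=
  forall f : 'M[R]_(2, n) -> 'rV[R]_(d.+1),
    {within sdj_realization (R:=R) E, continuous f} ->
    exists x, sdj_realization (R:=R) E x /\ f x = f (sdj_inv x).

Definition gnp_weight (R : realType) n (p : R) (E : {set {set 'I_n}}) : R :=
  \prod_(e : {set 'I_n} | #|e| == 2%N) (if e \in E then p else 1 - p).

Definition gnp_prob (R : realType) n (p : R) (P : {set {set 'I_n}} -> Prop) : R :=
  \sum_(E : {set {set 'I_n}} | is_graph E) (asbool (P E))%:R * gnp_weight p E.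

(* Main.v *)
(* The separated deleted join Z of the clique complex of G is itself a flag
   complex, on the vertex set V x {+,-}.

   (1) If alpha < 1/d then with high probability Z has no reduced homology mod 2
   in dimensions at most d. Adding a missing edge uv to a flag complex does not
   kill homology in dimension i when the common link of u and v is acyclic in
   dimension i - 1, and a flag complex in which all vertices of one sign are
   pairwise adjacent is acyclic as soon as every small clique of the other sign
   has a common neighbour of that sign. Alternating these two facts reduces the
   claim to two properties of G: at most d vertices have a common neighbour that
   avoids the neighbourhoods of boundedly many other vertices, and the graph
   induced on the common neighbourhood of at most d - 1 vertices, with such
   neighbourhoods removed, is connected. Both follow from a union bound.

   (2) Acyclicity yields chains c_0, ..., c_(d+1) with c_0 a vertex and
   bd c_(j+1) = c_j + iota c_j. If f(x) <> f(iota x) throughout, labelling points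
   by the dominant coordinate of f(x) - f(iota x) and its sign gives, on a fine
   barycentric subdivision, a labelling without complementary edges, and Ky Fan's
   parity count applied to the subdivided chains produces a simplex with d + 2
   distinct axes among d + 1. *)

Require Import Defs.
From HB Require Import structures.
From mathcomp Require Import all_boot all_order all_algebra.
From mathcomp Require Import zify ring lra.
From mathcomp Require Import reals normedtype.
Set Implicit Arguments. Unset Strict Implicit. Unset Printing Implicit Defensive.
Import Order.TTheory GRing.Theory Num.Theory.
Local Open Scope ring_scope.

(** * Chains modulo 2 on flag complexes *)

(** Removing one dimension costs two further vertices of one sign in the set whose link is taken,
    while common neighbours are available only for at most [d] vertices. Charging every dimension to
    one sign would overrun this budget. So the upper dimensions are charged to one sign and the
    lower ones to the other. Non-neighbours are cheap, which is why the opposite side and the faces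
    to be coned off may be as large as a constant [M]. Connectivity of a neighbourhood that is
    itself random is awkward to condition on. It is replaced by properties of all fixed vertex sets:
    each set of at most [s0] vertices, [s0] being about [n ^ alpha], has a neighbour outside it in
    the prescribed neighbourhood, and two disjoint sets of size [s0] have a common one. The former
    excludes small components, the latter joins large ones. In the parts on links and on random
    graphs, [d] is one less than the [d] of the theorem. *)

Lemma F2_addxx (x : 'F_2) : x + x = 0.
Proof. by apply/val_inj; case: x => [[|[|m]] i]. Qed.

Lemma F2_add_eq0 (x y : 'F_2) : (x + y == 0) = (x == y).
Proof. by case: x y => [[|[|m]] i] [[|[|m']] i']. Qed.

(** The terms at [(x, y)] and [(y, x)] cancel mod 2. This is the reason that [bnd] squares to
    zero. *)
Lemma F2_sum_symmetric (I : finType) (P : rel I) (F : I -> I -> 'F_2) :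
  symmetric P -> irreflexive P -> (forall x y, F x y = F y x) ->
  \sum_x \sum_(y | P x y) F x y = 0.
Proof.
move=> Psym Pirr Fsym.
pose lt (x y : I) := (enum_rank x < enum_rank y)%N.
have -> : \sum_x \sum_(y | P x y) F x y =
    \sum_x \sum_(y | P x y && lt x y) F x y +
    \sum_x \sum_(y | P x y && ~~ lt x y) F x y.
  by rewrite -big_split; apply: eq_bigr => x _; rewrite /= -bigID.
suff -> : \sum_x \sum_(y | P x y && ~~ lt x y) F x y =
          \sum_x \sum_(y | P x y && lt x y) F x y by rewrite F2_addxx.
rewrite (exchange_big_dep predT) //=; apply: eq_bigr => x _.
apply: eq_big => [y|y _]; last exact: Fsym.
rewrite Psym /lt; case Pxy: (P x y) => //=; rewrite -leqNgt leq_eqVlt.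
case: eqP => // /val_inj /enum_rank_inj xy.
by rewrite xy Pirr in Pxy.
Qed.

Section Chains.
Variable T : finType.
Implicit Types (s t : {set T}) (z w q c : {set T} -> 'F_2) (X : pred {set T}).

(* The augmented boundary: the empty set is a simplex of size 0. *)
Definition bnd z s := \sum_(x | x \notin s) z (x |: s).

Lemma bndD z w s : bnd (fun s => z s + w s) s = bnd z s + bnd w s.
Proof. exact: big_split. Qed.

Lemma bnd0 s : bnd (fun=> 0) s = 0.
Proof. exact: big1. Qed.

Lemma bnd_bnd z s : bnd (bnd z) s = 0.
Proof.
pose P x y := [&& x \notin s, y \notin s & x != y].
rewrite -[RHS](@F2_sum_symmetric T P (fun x y => z (y |: (x |: s)))).
- rewrite /bnd big_mkcond; apply: eq_bigr => x _.
  case: ifPn => xs; last first.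
    by rewrite big_pred0 // => y; rewrite /P (negbTE xs).
  apply: eq_bigl => y; rewrite /P xs in_setU1 negb_or andbC.
  by rewrite (eq_sym y x).
- by move=> x y; rewrite /P eq_sym; case: (x \notin s); rewrite ?andbF.
- by move=> x; rewrite /P eqxx !andbF.
- by move=> x y; rewrite setUCA.
Qed.

Definition chain_on X k z := forall s, z s != 0 -> X s /\ #|s| = k.

(** Faces are graded by their number of vertices, so this is the vanishing of reduced homology in
    dimension [k - 1]. For a clique complex, [k = 0] says that there is a vertex and [k = 1] that
    the complex is connected. *)
Definition acyclic X k := forall z, chain_on X k z -> bnd z =1 (fun=> 0) ->
  exists2 w, chain_on X k.+1 w & bnd w =1 z.

Lemma chain_onD X k z w :
  chain_on X k z -> chain_on X k w -> chain_on X k (fun s => z s + w s).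
Proof.
move=> hz hw s; have [z0|nz _] := eqVneq (z s) 0; last exact: hz.
by rewrite z0 add0r => /hw.
Qed.

Lemma bnd_neq0 z s : bnd z s != 0 -> exists2 x, x \notin s & z (x |: s) != 0.
Proof.
move=> nz; have [x /andP[xs zx]|no] := pickP [pred x | (x \notin s) && (z (x |: s) != 0)].
  by exists x.
case/eqP: nz; apply: big1 => x xs.
by have := no x; rewrite /= xs /= => /negbFE/eqP.
Qed.

Definition clique (e : rel T) (W : {set T}) s :=
  (s \subset W) && [forall x in s, forall y in s, (x != y) ==> e x y].

Lemma cliqueP (e : rel T) (W : {set T}) s :
  reflect ((forall x, x \in s -> x \in W) /\
           (forall x y, x \in s -> y \in s -> x != y -> e x y)) (clique e W s).
Proof.
apply: (iffP andP) => -[].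
  move=> /subsetP sW /forall_inP h; split=> // x y xs ys xy.
  by move: (h x xs) => /forall_inP/(_ y ys)/implyP; apply.
move=> sW h; split; first exact/subsetP.
apply/forall_inP => x xs; apply/forall_inP => y ys; apply/implyP.
exact: h.
Qed.

Lemma clique_sub (e : rel T) (W : {set T}) s t : s \subset t -> clique e W t -> clique e W s.
Proof.
move=> /subsetP st /cliqueP[tW te]; apply/cliqueP; split=> [x /st|x y /st + /st].
  exact: tW.
exact: te.
Qed.

Lemma chain_on_bnd (e : rel T) (W : {set T}) k z :
  chain_on (clique e W) k.+1 z -> chain_on (clique e W) k (bnd z).
Proof.
move=> hz s /bnd_neq0[x xs /hz[cl]]; rewrite cardsU1 xs => -[<-]; split=> //.
exact: clique_sub (subsetUr _ _) cl.
Qed.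

Definition nbr (e : rel T) u := [set x | e u x].

Definition add_edge (e : rel T) u v : rel T :=
  fun x y => [|| e x y, (x == u) && (y == v) | (x == v) && (y == u)].

(* The pair (X + uv, X) has the homology of the double suspension of the link
   of uv. *)
Lemma acyclic_add_edge (e : rel T) (W : {set T}) u v k :
  symmetric e -> irreflexive e -> u \in W -> v \in W -> u != v -> ~~ e u v ->
  acyclic (clique e (W :&: nbr e u :&: nbr e v)) k ->
  acyclic (clique (add_edge e u v) W) k.+1 ->
  acyclic (clique e W) k.+1.
Proof.
move=> esym eirr uW vW uv euv hlink hadd z hz zcyc.
have vu : v != u by rewrite eq_sym.
have sub_add s : clique e W s -> clique (add_edge e u v) W s.
  move=> /cliqueP[sW se]; apply/cliqueP; split=> // x y xs ys xy.
  by rewrite /add_edge se.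
have [|w hw wz] := hadd z _ zcyc; first by move=> s /hz[/sub_add].
(* The part of [w] through the new edge, with that edge removed. It is a cycle in the link because
   [z = bnd w] has no face containing both [u] and [v]. *)
pose y s := if (u \notin s) && (v \notin s) then w (u |: (v |: s)) else 0.
have [||q hq qy] := hlink y.
- move=> s; rewrite /y; case: ifP => [/andP[us vs]|_]; last by rewrite eqxx.
  move=> /hw[/cliqueP[sW se]]; rewrite !cardsU1 !inE negb_or uv us vs => -[<-].
  split=> //; apply/cliqueP; split=> [x xs|x x' xs x's xx'].
    have xu : x != u by apply: contraTneq xs => ->.
    have xv : x != v by apply: contraTneq xs => ->.
    rewrite !inE sW ?inE ?xs ?orbT //=.
    have := se u x; rewrite !inE eqxx xs !orbT (eq_sym u x) xu => /(_ isT isT isT).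
    have := se v x; rewrite !inE eqxx xs !orbT (eq_sym v x) xv => /(_ isT isT isT).
    rewrite /add_edge !(negbTE xu) !(negbTE xv) !andbF !orbF.
    by move=> -> ->.
  have := se x x'; rewrite !inE xs x's !orbT => /(_ isT isT xx').
  rewrite /add_edge.
  have xu : x != u by apply: contraTneq xs => ->.
  have xv : x != v by apply: contraTneq xs => ->.
  by rewrite (negbTE xu) (negbTE xv) !orbF.
- move=> s; have [/andP[us vs]|ns] := boolP ((u \notin s) && (v \notin s)); last first.
    apply: big1 => x _; rewrite /y !inE !negb_or.
    case: ifP => // /andP[/andP[_ us] /andP[_ vs]].
    by rewrite us vs in ns.
  have z0 : z (u |: (v |: s)) = 0.
    apply/eqP; apply: contraT => /hz[/cliqueP[_ /(_ u v)]].
    by rewrite !inE !eqxx uv !orbT (negbTE euv) => /(_ isT isT isT).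
  rewrite -[RHS]z0 -wz /bnd; rewrite [LHS](bigID (fun x => (x != u) && (x != v))) /=.
  rewrite [X in _ + X]big1 ?addr0; last first.
    move=> x /andP[xs]; rewrite negb_and !negbK /y !inE.
    by case/orP => /eqP->; rewrite eqxx ?andbF.
  apply: eq_big => [x|x /andP[xs /andP[xu xv]]].
    by rewrite !inE !negb_or; case: (x \in s); rewrite /= ?andbF ?andbT.
  rewrite /y !inE !negb_or us vs !andbT (eq_sym u) (eq_sym v) xu xv.
  by congr w; rewrite !(setUCA [set x]).
have qu s : q s != 0 -> (u \notin s) && (v \notin s).
  move=> /hq[/cliqueP[sW _] _]; apply/andP; split; apply/negP => /sW; rewrite !inE eirr ?andbF //.
(* The join of the edge [uv] with the filling [q] of [y]. Adding its boundary to [w] does not change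
   [bnd w] and cancels every face of [w] through [uv]. *)
pose uvq t := if (u \in t) && (v \in t) then q (t :\ u :\ v) else 0.
pose w' s := w s + bnd uvq s.
have huvq : chain_on (clique (add_edge e u v) W) k.+3 uvq.
  move=> t; rewrite /uvq; case: ifP => [/andP[ut vt]|_]; last by rewrite eqxx.
  move=> qt; have [/cliqueP[sW se] ck] := hq _ qt.
  have vtu : v \in t :\ u by rewrite !inE vu vt.
  split; last by rewrite (cardsD1 u) (cardsD1 v (t :\ u)) ut vtu ck.
  have euvx x : x \in t -> x != u -> x != v -> [&& x \in W, e u x & e v x].
    by move=> xt xu xv; have := sW x; rewrite !inE xu xv xt => /(_ isT); rewrite andbA.
  apply/cliqueP; split=> [x xt|x x' xt x't xx'].
    have [->//|xu] := eqVneq x u; have [->//|xv] := eqVneq x v.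
    by case/and3P: (euvx x xt xu xv).
  rewrite /add_edge.
  have [xu|xu] := eqVneq x u.
    have [x'v|x'v] := eqVneq x' v; first by rewrite orbT.
    have x'u : x' != u by rewrite eq_sym -xu.
    by rewrite xu; case/and3P: (euvx x' x't x'u x'v) => _ -> _.
  have [xv|xv] := eqVneq x v.
    have [x'u|x'u] := eqVneq x' u; first by rewrite !orbT.
    have x'v : x' != v by rewrite eq_sym -xv.
    by rewrite xv; case/and3P: (euvx x' x't x'u x'v) => _ _ ->.
  have [x'u|x'u] := eqVneq x' u.
    by rewrite x'u (esym x); case/and3P: (euvx x xt xu xv) => _ -> _.
  have [x'v|x'v] := eqVneq x' v.
    by rewrite x'v (esym x); case/and3P: (euvx x xt xu xv) => _ _ ->.
  by rewrite se // !inE ?xu ?xv ?xt ?x'u ?x'v.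
exists w'; last by move=> s; rewrite bndD bnd_bnd addr0 wz.
move=> s ws.
have [cls cs] : clique (add_edge e u v) W s /\ #|s| = k.+2.
  by apply: (chain_onD hw (chain_on_bnd huvq)) ws.
split=> //; case/cliqueP: cls => sW se; apply/cliqueP; split=> // x x' xs x's xx'.
have [/andP[us vs]|nuv] := boolP ((u \in s) && (v \in s)); last first.
  have := se x x' xs x's xx'; rewrite /add_edge => /or3P[//|/andP[/eqP xu /eqP xv]|/andP[/eqP xu /eqP xv]];
  by subst; rewrite xs x's in nuv.
case/eqP: ws; rewrite /w'.
have -> : bnd uvq s = bnd q (s :\ u :\ v).
  rewrite /bnd [RHS](bigID (fun x => x \in s)) /= [X in X + _]big1 ?add0r.
    apply: eq_big => [a|a as_].
      by rewrite !inE; case: (a \in s); rewrite ?andbF ?andbT.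
    rewrite /uvq !inE us vs !orbT; congr q; apply/setP => b; rewrite !inE.
    have [->|_] := eqVneq b a => //=.
    by rewrite (contraNneq _ as_) ?(contraNneq _ as_) // => ->.
  move=> a /andP[]; rewrite !inE => ha as_; apply/eqP; apply: contraNT ha => /qu.
  by rewrite !inE !negb_or as_ andbT (eq_sym u) (eq_sym v) => /andP[/andP[-> _] /andP[-> _]].
rewrite qy /y !inE !eqxx /= andbF /=.
have -> : u |: (v |: s :\ u :\ v) = s by rewrite setD1K ?inE ?vu ?vs // setD1K.
by rewrite F2_addxx.
Qed.

(** The cycle is coned off one level at a time, the level of a face being its number of negative
    vertices. The apex of a face is chosen from its negative part alone, so it is unchanged when a
    positive vertex is added. The cone over a clique is a clique because positive vertices are
    pairwise adjacent. *)
Lemma acyclic_complete (e : rel T) (W : {set T}) (neg : pred T) k :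
  (forall x y, x \in W -> y \in W -> ~~ neg x -> ~~ neg y -> x != y -> e x y) ->
  (forall s, clique e W s -> {in s, forall x, neg x} -> (#|s| <= k)%N ->
    exists x, [/\ x \in W, ~~ neg x & forall y, y \in s -> e x y /\ e y x]) ->
  acyclic (clique e W) k.
Proof.
move=> epos eapex.
pose ng s := [set x in s | neg x].
pose good s x := [&& x \in W, ~~ neg x & [forall y in ng s, e x y && e y x]].
pose apex s := [pick x | good s x].
have apex_ex s : clique e W s -> (#|s| <= k)%N -> exists2 x, apex s = Some x & good s x.
  move=> cls sk; rewrite /apex; case: pickP => [x gx|no]; first by exists x.
  have [|||x [xW xn xe]] := eapex (ng s).
  - by apply: clique_sub cls; apply/subsetP => x; rewrite inE => /andP[].
  - by move=> x; rewrite inE => /andP[].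
  - by apply: leq_trans sk; apply/subset_leq_card/subsetP => x; rewrite inE => /andP[].
  have := no x; rewrite /good xW xn /= => /negbT/forall_inPn[y ys].
  by have [-> ->] := xe y ys.
have apexU s x : ~~ neg x -> apex (x |: s) = apex s.
  move=> nx; rewrite /apex; apply: eq_pick => y; rewrite /good; congr [&& _, _ & _].
  suff -> : ng (x |: s) = ng s by [].
  apply/setP => b; rewrite !inE.
  by case: eqVneq => // ->; rewrite (negbTE nx) !andbF.
suff main j z : chain_on (clique e W) k z -> bnd z =1 (fun=> 0) ->
    (forall s, z s != 0 -> (#|ng s| < j)%N) ->
    exists2 w, chain_on (clique e W) k.+1 w & bnd w =1 z.
  by move=> z hz zc; apply: (main #|T|.+1 z hz zc) => s _; rewrite ltnS max_card.
elim: j z => [|j IH] z hz zc zj.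
  exists (fun=> 0); first by move=> s; rewrite eqxx.
  by move=> s; rewrite bnd0; apply/esym/eqP; apply: contraT => /zj.
(* The cone on [z]: each face that lacks its apex is joined to it. The face [t :\ x] has the same
   apex as [t], since [x] is positive. *)
pose D t := if apex t is Some x then if x \in t then z (t :\ x) else 0 else 0.
have hD : chain_on (clique e W) k.+1 D.
  move=> t; rewrite /D; case E: (apex t) => [x|]; last by rewrite eqxx.
  case: ifP => [xt|_]; last by rewrite eqxx.
  move=> /hz[/cliqueP[sW se] <-]; split; last by rewrite (cardsD1 x) xt.
  have gx : good t x by move: E; rewrite /apex; case: pickP => // x' ? [<-].
  case/and3P: gx => xW nx /forall_inP xe.
  have xadj y : y \in t -> y != x -> e x y && e y x.
    move=> yt yx; have yW : y \in W by apply: sW; rewrite !inE yx.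
    have [ny|ny] := boolP (neg y); first by rewrite xe // inE yt.
    by rewrite !epos // eq_sym.
  apply/cliqueP; split=> [y yt|y y' yt y't yy'].
    by have [->//|yx] := eqVneq y x; apply: sW; rewrite !inE yx.
  have [yx|yx] := eqVneq y x.
    have y'x : y' != x by rewrite eq_sym -yx.
    by rewrite yx; case/andP: (xadj y' y't y'x).
  have [y'x|y'x] := eqVneq y' x.
    by have /andP[_] := xadj y yt yx; rewrite y'x.
  by apply: se; rewrite // !inE ?yx ?y'x.
pose z' s := z s + bnd D s.
have z'c : bnd z' =1 (fun=> 0) by move=> s; rewrite bndD bnd_bnd zc addr0.
have hz' : chain_on (clique e W) k z' := chain_onD hz (chain_on_bnd hD).
(* Only the top level has to cancel. There, a further negative vertex leads outside the support of
   [z], so both [bnd D] and the cycle equation reduce to positive vertices, for which the apex stays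
   that of [s]. *)
have z'j s : z' s != 0 -> (#|ng s| < j)%N.
  rewrite ltnNge; apply: contra => js.
  have [cls|ncls] := boolP (clique e W s && (#|s| == k)); last first.
    by apply: contraT => /hz'[cl ck]; rewrite cl ck eqxx in ncls.
  case/andP: cls => cls /eqP sk.
  have [a Ea /and3P[aW na ae]] := apex_ex s cls (eq_leq sk).
  have zneg x t : x \notin s -> neg x -> s :\ a \subset t -> x \in t -> z t = 0.
    move=> xs nx st xt; apply/eqP; apply: contraT => /zj.
    suff : (j < #|ng t|)%N by move=> h; rewrite ltnS leqNgt h.
    apply: leq_ltn_trans js _; apply: proper_card; apply/properP; split.
      apply/subsetP => b; rewrite !inE => /andP[bs bn]; rewrite bn andbT.
      apply: (subsetP st); rewrite !inE bs andbT.
      by apply: contraTneq bn => ->.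
    by exists x; rewrite !inE ?xt ?(negbTE xs).
  have D_neg x : x \notin s -> neg x -> D (x |: s) = 0.
    move=> xs nx; rewrite /D; case E: (apex _) => [b|//]; case: ifP => // bs.
    have gb : good (x |: s) b by move: E; rewrite /apex; case: pickP => // x' ? [<-].
    case/and3P: gb => _ nb _; apply/eqP; apply: contraT => /zj.
    suff : (j < #|ng ((x |: s) :\ b)|)%N by move=> h; rewrite ltnS leqNgt h.
    apply: leq_ltn_trans js _; apply: proper_card; apply/properP; split.
      apply/subsetP => c; rewrite !inE => /andP[cs cn]; rewrite cn cs orbT !andbT.
      by apply: contraTneq cn => ->.
    exists x; rewrite !inE ?(negbTE xs) // nx eqxx /= !andbT.
    by apply: contraNneq nb => <-.
  have D_pos x : x \notin s -> ~~ neg x -> D (x |: s) = if a \in x |: s then z ((x |: s) :\ a) else 0.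
    by move=> xs nx; rewrite /D apexU // Ea.
  (* If the apex [a] is not in [s], only the face [a |: s] contributes, and it gives back [z s].
     Otherwise the sum is the cycle equation of [z] at [s :\ a] without its term [z s]. *)
  have [as_|as_] := boolP (a \in s); last first.
    rewrite F2_add_eq0 /bnd (bigD1 a) //= D_pos // !inE eqxx /=.
    rewrite setU1K // big1 ?addr0 // => x /andP[xs xa].
    have [nx|nx] := boolP (neg x); first exact: D_neg.
    by rewrite D_pos // !inE (negbTE as_) orbF eq_sym (negbTE xa).
  rewrite F2_add_eq0 -F2_add_eq0 -[0](zc (s :\ a)) /bnd eq_sym.
  rewrite (bigD1 a) ?inE ?eqxx //= setD1K //; apply/eqP; congr (_ + _).
  apply: eq_big => [x|x].
    by rewrite !inE; have [->|] := eqVneq x a; rewrite ?as_ ?andbF ?andbT.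
  rewrite !inE => /andP[]; rewrite negb_and negbK => + xa.
  rewrite (negbTE xa) /= => xs.
  have -> : x |: s :\ a = (x |: s) :\ a.
    by apply/setP => b; rewrite !inE; case: (eqVneq b x) => // ->; rewrite xa.
  have [nx|nx] := boolP (neg x); last by rewrite D_pos // !inE as_ orbT.
  rewrite D_neg // (zneg x) // ?inE ?xa ?eqxx //.
  by apply: setSD; apply: subsetUr.
have [w hw wz] := IH z' hz' z'c z'j.
exists (fun s => w s + D s); first exact: chain_onD.
by move=> s; rewrite bndD wz /z' -addrA F2_addxx addr0.
Qed.

End Chains.

(** * Acyclicity of the separated deleted join *)

Section Connected.
Variables (T : finType) (e : rel T) (W : {set T}).

Definition point_chain (u : T) (s : {set T}) : 'F_2 := (s == [set u])%:R.

Lemma bnd_edge (x y : T) : x != y ->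
  bnd (fun s => (s == [set x; y])%:R : 'F_2) =1
  (fun s => point_chain x s + point_chain y s).
Proof.
move=> xy.
have edge (u v : T) : u != v -> forall s, s = [set u] -> bnd (fun s => (s == [set u; v])%:R : 'F_2) s = 1.
  move=> uv s ->; rewrite /bnd (bigD1 v) /=; last by rewrite inE eq_sym.
  rewrite setUC eqxx big1 ?addr0 // => a /andP[]; rewrite inE => au av.
  case: eqP => // /setP/(_ a); rewrite !inE eqxx (negbTE au) (negbTE av).
  by [].
move=> s; rewrite /point_chain.
have [sx|nsx] := eqVneq s [set x].
  rewrite (edge x y) // sx (inj_eq set1_inj) (negbTE xy) addr0 //.
have [sy|nsy] := eqVneq s [set y].
  by rewrite setUC (edge y x) ?add0r // eq_sym.
rewrite addr0 /bnd big1 // => a as_; case: eqP => // E.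
have : a \in [set x; y] by rewrite -E !inE eqxx.
have sE : s = (a |: s) :\ a by rewrite setU1K.
rewrite !inE => /orP[]/eqP ax; subst a.
  by case/eqP: nsy; rewrite sE E setU1K // inE.
by case/eqP: nsx; rewrite sE E setUC setU1K // inE eq_sym.
Qed.

Lemma chain_of_connect u v :
  symmetric e -> irreflexive e -> u \in W ->
  connect (fun x y => e x y && (y \in W)) u v ->
  exists2 w, chain_on (clique e W) 2 w &
    bnd w =1 (fun s => point_chain u s + point_chain v s).
Proof.
move=> esym eirr uW /connectP[p + ->]; elim: p u uW => [|y p IH] u uW /=.
  move=> _; exists (fun=> 0); first by move=> s; rewrite eqxx.
  by move=> s; rewrite bnd0 F2_addxx.
case/andP=> /andP[euy yW] /(IH _ yW)[w hw bw].
have uy : u != y by apply: contraTneq euy => ->; rewrite eirr.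
exists (fun s => (s == [set u; y])%:R + w s); last first.
  move=> s; rewrite bndD bnd_edge // bw addrACA -addrA.
  by rewrite [X in _ + X]addrA F2_addxx add0r.
apply: chain_onD hw => s; case: (eqVneq s [set u; y]) => [-> _|_]; last by rewrite eqxx.
split; last by rewrite cards2 uy.
apply/cliqueP; split=> [x|x x']; rewrite !inE => /orP[]/eqP-> //.
  by case/orP => /eqP->; rewrite ?eqxx ?euy.
by case/orP => /eqP->; rewrite ?eqxx 1?esym ?euy.
Qed.

(** Each vertex of the cycle is joined to [u0] by a path. The boundary at the empty face says that
    the number of these vertices is even, so the copies of [u0] cancel. *)
Lemma acyclic1_connected u0 :
  symmetric e -> irreflexive e -> u0 \in W ->
  (forall u, u \in W -> connect (fun x y => e x y && (y \in W)) u u0) ->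
  acyclic (clique e W) 1.
Proof.
move=> esym eirr u0W hconn z hz zc.
have [w hw] : exists w : T -> {set T} -> 'F_2, forall u, u \in W ->
    chain_on (clique e W) 2 (w u) /\
    bnd (w u) =1 (fun s => point_chain u s + point_chain u0 s).
  apply: (@fin_all_exists T (fun=> {set T} -> 'F_2)
    (fun u wu => u \in W -> chain_on (clique e W) 2 wu /\
      bnd wu =1 (fun s => point_chain u s + point_chain u0 s))) => u.
  have [uW|uW] := boolP (u \in W); last by exists (fun=> 0).
  by have [wu ? ?] := chain_of_connect esym eirr uW (hconn u uW); exists wu.
have zW u : z [set u] != 0 -> u \in W.
  by move=> /hz[/cliqueP[h _] _]; apply: h; rewrite inE.
exists (fun s => \sum_u z [set u] * w u s) => [s nz|s].
  have [u uP|no] := pickP [pred u | z [set u] * w u s != 0]; last first.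
    by case/eqP: nz; apply: big1 => u _; have /negbFE/eqP := no u.
  move: uP; rewrite /= mulf_eq0 negb_or => /andP[/zW uW].
  by have [h _] := hw u uW; apply: h.
rewrite /bnd exchange_big /=.
rewrite (eq_bigr (fun u => z [set u] * (point_chain u s + point_chain u0 s))); last first.
  move=> u _; rewrite -mulr_sumr; have [->|zu] := eqVneq (z [set u]) 0.
    by rewrite !mul0r.
  by have [_ <-] := hw u (zW u zu).
under eq_bigr do rewrite mulrDr.
rewrite big_split /= -mulr_suml.
have -> : \sum_u z [set u] = 0.
  rewrite -[RHS](zc set0) /bnd; apply: eq_big => [x|x _]; first by rewrite inE.
  by rewrite setU0.
rewrite mul0r addr0.
have [/cards1P[x ->]|s1] := boolP (#|s| == 1%N).
  rewrite (bigD1 x) //= /point_chain eqxx mulr1 big1 ?addr0 // => u ux.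
  by rewrite (inj_eq set1_inj) eq_sym (negbTE ux) mulr0.
have -> : z s = 0 by apply/eqP; apply: contraNT s1 => /hz[_ ->].
apply: big1 => u _; rewrite /point_chain; case: eqP => [E|]; last by rewrite mulr0.
by rewrite E cards1 in s1.
Qed.
End Connected.

Lemma disjoint_setU1 (T : finType) (x : T) (A B : {set T}) :
  [disjoint x |: A & B] = (x \notin B) && [disjoint A & B].
Proof. by rewrite -!setI_eq0 setIUl setU_eq0 setI_eq0 disjoints1. Qed.

Lemma negb_of_neq (b c : bool) : b != c -> b = ~~ c.
Proof. by case: b c => [] []. Qed.

(** * Links in the separated deleted join and in its enlargements *)

Section SeparatedJoin.
Variables (V : finType) (g : rel V).
Hypotheses (gsym : symmetric g) (girr : irreflexive g).
Notation T := (bool * V)%type.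

Definition nbhd (A B : {set V}) : {set V} :=
  [set w | [&& w \notin B, [forall a in A, g a w] & [forall b in B, ~~ g b w]]].

Lemma nbhdP (A B : {set V}) w : reflect [/\ w \notin B, forall a, a \in A -> g a w
   & forall b, b \in B -> ~~ g b w] (w \in nbhd A B).
Proof.
rewrite inE; apply: (iffP and3P) => -[wB hA hB]; split=> //.
- exact/forall_inP.
- exact/forall_inP.
- exact/forall_inP.
- exact/forall_inP.
Qed.

Definition extension_property d M := forall A B : {set V},
  (#|A| <= d)%N -> (#|B| <= M)%N -> [disjoint A & B] -> exists w, w \in nbhd A B.

Definition connection_property d M := forall A B : {set V},
  (#|A| <= d)%N -> (#|B| <= M)%N -> [disjoint A & B] ->
  forall u v, u \in nbhd A B -> v \in nbhd A B ->
  connect (fun x y => g x y && (y \in nbhd A B)) u v.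

(** The conditions on a face of the separated deleted join are conditions on pairs of signed
    vertices; this is the graph whose cliques are these faces. *)
Definition sep_rel : rel T := fun a b =>
  if a.1 == b.1 then g a.2 b.2 else (a.2 != b.2) && ~~ g a.2 b.2.

(** The graphs met while edges between vertices of equal sign are added to [sep_rel]. Mixed edges
    never change, so they keep expressing non-adjacency in [g]. *)
Definition admissible (e : rel T) := [/\ symmetric e, irreflexive e,
  forall s x y, e (s, x) (~~ s, y) = (x != y) && ~~ g x y
  & forall s x y, g x y -> e (s, x) (s, y)].

Definition common_nbr (e : rel T) (A : {set T}) := [set x | [forall a in A, e a x]].

Lemma common_nbrP (e : rel T) (A : {set T}) x :
  reflect (forall a, a \in A -> e a x) (x \in common_nbr e A).
Proof. by rewrite inE; apply: forall_inP. Qed.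

Definition side s (A : {set T}) := [set x | (s, x) \in A].

Definition consistent (A : {set T}) := forall s x, (s, x) \in A -> (~~ s, x) \notin A.

Definition links_acyclic s k a b := forall e A, admissible e -> consistent A ->
  (#|side s A| <= a)%N -> (#|side (~~ s) A| <= b)%N ->
  acyclic (clique e (common_nbr e A)) k.

Lemma links_acyclicN s k a b : links_acyclic s k a b -> links_acyclic (~~ s) k b a.
Proof. by move=> h e A he hA ha hb; apply: h => //; rewrite -[s]negbK. Qed.

Variables (d M : nat).
Hypotheses (Hext : extension_property d.+1 M) (Hconn : connection_property d M).

Lemma consistent_disjoint s (A : {set T}) (B : {set V}) : consistent A ->
  (forall x, x \in B -> (~~ s, x) \in A \/ (s, x) \notin A) ->
  [disjoint side s A & B].
Proof.
move=> hA hB; rewrite disjoint_subset; apply/subsetP => x; rewrite !inE => xA.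
by apply/negP => /hB[]; rewrite ?xA // (negbTE (hA _ _ xA)).
Qed.

(** Induction on the number of non-adjacent pairs. A missing edge of sign [s] puts its two ends into
    [A], whence [a.+2] at one dimension less. Once none is left, the apexes come from [Hext]: they
    see at most [a] vertices and avoid at most [b] vertices of [A] and [k.+1] of the face. *)
Lemma links_acyclic_step s k a b : (a <= d.+1)%N -> (b + k.+1 <= M)%N ->
  links_acyclic s k a.+2 b -> links_acyclic s k.+1 a b.
Proof.
move=> ad bM IH e A.
have [m] := ubnP #|[set xy : T * T | ~~ e xy.1 xy.2]|.
elim: m e => // m IHm e; rewrite ltnS => em he hA sa sb.
have [esym eirr emix esame] := he.
have [[u v] /= /and5P[/andP[/eqP us /eqP vs] uW vW uv euv]|no] := pickP [pred uv : T * T |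
  [&& (uv.1.1 == s) && (uv.2.1 == s), uv.1 \in common_nbr e A, uv.2 \in common_nbr e A,
      uv.1 != uv.2 & ~~ e uv.1 uv.2]].
  have uA : u \notin A by apply/negP => /(common_nbrP _ _ _ uW); rewrite eirr.
  have vA : v \notin A by apply/negP => /(common_nbrP _ _ _ vW); rewrite eirr.
  apply: (@acyclic_add_edge _ e _ u v) => //.
    have -> : common_nbr e A :&: nbr e u :&: nbr e v = common_nbr e (u |: (v |: A)).
      apply/setP => x; rewrite !inE; apply/idP/idP.
        case/andP=> /andP[/forall_inP h ux vx]; apply/forall_inP => c.
        by rewrite !inE => /or3P[/eqP->|/eqP->|/h].
      move=> /forall_inP h; rewrite !h ?inE ?eqxx ?orbT // !andbT.
      by apply/forall_inP => c cA; apply: h; rewrite !inE cA !orbT.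
    (* Mixed edges join distinct vertices of [V], so a vertex of the link is never the twin of one
       in [A]. Hence [A] stays consistent when [u] and [v] are added. *)
    have fresh w x : w.1 = s -> w \in common_nbr e A -> w.2 = x -> (~~ s, x) \notin A.
      case: w => w1 w2 /= -> /common_nbrP h <-; apply/negP => /h.
      by rewrite -{2}[s]negbK emix eqxx.
    apply: IH => //.
    - case: u v us vs uW vW {uv euv uA vA} => [u1 u2] [v1 v2] /= us vs uW vW t x; subst u1 v1.
      rewrite !inE !xpair_eqE => /or3P[/andP[/eqP-> /eqP->]|/andP[/eqP-> /eqP->]|xA].
      + by rewrite !negb_or !negb_and (fresh _ _ _ uW) //; case: (s).
      + by rewrite !negb_or !negb_and (fresh _ _ _ vW) //; case: (s).
      + rewrite !negb_or !negb_and (hA _ _ xA) andbT.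
        have [ts|ts] := eqVneq (~~ t) s => //=.
        have tE : t = ~~ s by rewrite -ts negbK.
        move: xA; rewrite tE => xA; apply/andP; split; apply: contraTneq xA => ->.
          exact: (fresh _ _ _ uW).
        exact: (fresh _ _ _ vW).
    - apply: leq_trans (_ : #|[set u.2] :|: ([set v.2] :|: side s A)| <= _)%N.
        apply/subset_leq_card/subsetP => x; rewrite !inE.
        by case: (u) (v) us vs => [u1 u2] [v1 v2] /= -> ->; rewrite !xpair_eqE eqxx.
      by rewrite !cardsU1; apply: leq_add (leq_b1 _) (leq_add (leq_b1 _) sa).
    - apply: leq_trans sb; apply/subset_leq_card/subsetP => x; rewrite !inE.
      by case: (u) (v) us vs => [u1 u2] [v1 v2] /= -> ->; rewrite !xpair_eqE; case: (s).
  have uv1 : (u == v) = false by apply/negbTE.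
  (* Neither end of the new edge lies in [A], so the vertex set of the link does not change. *)
  have cE : common_nbr (add_edge e u v) A = common_nbr e A.
    apply/setP => x; rewrite !inE; apply: eq_forallb_in => c cA; rewrite /add_edge.
    have /negbTE-> : c != u by apply: contraNneq uA => <-.
    have /negbTE-> : c != v by apply: contraNneq vA => <-.
    by rewrite /= orbF.
  rewrite -cE; apply: IHm => //.
    apply: leq_trans em; apply: proper_card; apply/properP; split.
      by apply/subsetP => -[x y]; rewrite !inE /= /add_edge !negb_or => /andP[].
    by exists (u, v); rewrite !inE /= ?euv // /add_edge !eqxx !orbT.
  split.
  - by move=> x y; rewrite /add_edge esym; congr (_ || _); rewrite orbC andbC [in X in _ || X]andbC.
  - move=> x; rewrite /add_edge eirr /=; apply/negP => /orP[]/andP[/eqP-> ];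
    by rewrite ?uv1 // eq_sym uv1.
  - move=> t x y; rewrite /add_edge emix; case: (u) (v) us vs => [u1 u2] [v1 v2] /= -> ->.
    by rewrite !xpair_eqE; case: (t) (s) => [] [] /=; rewrite ?andbF /= ?orbF.
  - by move=> t x y gxy; rewrite /add_edge esame.
apply: (@acyclic_complete _ _ _ (fun x => x.1 != s)).
  move=> x y xW yW; rewrite !negbK => xs ys xy; apply: contraT => exy.
  by have := no (x, y); rewrite /= xs ys xW yW xy exy.
move=> t /cliqueP[tW _] tneg tk.
(* An apex of sign [s] is adjacent to a vertex of the other sign only if the two are not adjacent in
   [g], so all of these have to be avoided. *)
pose B := side (~~ s) A :|: [set x.2 | x in t].
have tE y : y \in t -> y = (~~ s, y.2).
  by move=> /tneg; case: y => [y1 y2] /= /negb_of_neq->.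
have [w /nbhdP[wB wA wnB]] : exists w, w \in nbhd (side s A) B.
  apply: Hext.
  - exact: leq_trans sa ad.
  - apply: leq_trans bM; apply: leq_trans (leq_card_setU _ _) _.
    by apply: leq_add => //; apply: leq_trans (leq_imset_card _ _) tk.
  - apply: consistent_disjoint => // x; rewrite !inE => /orP[|/imsetP[y yt xy]]; first by left.
    right; apply/negP => xA; have := tW y yt; rewrite (tE y yt) -xy => /common_nbrP/(_ _ xA).
    by rewrite emix eqxx.
have wmix x : x \in B -> e (s, w) (~~ s, x).
  move=> xB; rewrite emix gsym wnB // andbT.
  by apply: contraNneq wB => ->.
exists (s, w); split.
- apply/common_nbrP => -[c1 c2] cA; have [c1s|c1s] := eqVneq c1 s.
    by subst c1; apply: esame; apply: wA; rewrite inE.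
  have c1E : c1 = ~~ s by exact: negb_of_neq.
  by subst c1; rewrite esym wmix // !inE cA.
- by rewrite eqxx.
- move=> y yt; rewrite [e y _]esym (tE y yt) wmix //.
  by rewrite inE; apply/orP; right; apply/imsetP; exists y.
Qed.

(** The set [nbhd A' B'], taken with sign [~~ s], is a core that is connected by [Hconn], and every
    vertex of the link has a neighbour in it. For a vertex of sign [s] this takes one more vertex to
    avoid, whence [a < M]. For one of sign [~~ s], which may be outside the core as [e] can have
    more edges than [g], it takes a common neighbour of [b + 1] vertices, whence [b <= d]. *)
Lemma links_acyclic1 s a b : (b <= d)%N -> (a < M)%N -> links_acyclic s 1 a b.
Proof.
move=> bd aM e A he hA sa sb.
have [esym eirr emix esame] := he.
set A' := side (~~ s) A; set B' := side s A.
have dis : [disjoint A' & B'].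
  by apply: consistent_disjoint => // x; rewrite inE negbK; left.
have bM : (#|B'| <= M)%N by apply: leq_trans sa (ltnW aM).
have W_nbhd x : x \in nbhd A' B' -> (~~ s, x) \in common_nbr e A.
  move=> /nbhdP[xB xA xnB]; apply/common_nbrP => -[c1 c2] cA.
  have [c1s|c1s] := eqVneq c1 s.
    subst c1; rewrite emix xnB ?inE // andbT; apply: contraNneq xB => <-.
    by rewrite inE.
  have c1E : c1 = ~~ s by exact: negb_of_neq.
  by subst c1; apply: esame; apply: xA; rewrite inE.
have [x0 x0N] : exists w, w \in nbhd A' B'.
  by apply: Hext => //; apply: leq_trans sb (leq_trans bd (leqnSn _)).
have connN x y : x \in nbhd A' B' -> y \in nbhd A' B' ->
    connect (fun x y => e x y && (y \in common_nbr e A)) (~~ s, x) (~~ s, y).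
  move=> xN yN; have /connectP[p pp ->] := Hconn (leq_trans sb bd) bM dis xN yN.
  elim: p x pp {xN} => [|z p IHp] x /=; first by [].
  case/andP=> /andP[gxz zN] /IHp; apply: connect_trans; apply: connect1.
  by rewrite esame //= W_nbhd.
apply: (@acyclic1_connected _ _ _ (~~ s, x0)) => //; first exact: W_nbhd.
move=> [u1 u2] uW; have [u1s|u1s] := eqVneq u1 s.
  subst u1; move/common_nbrP: (uW) => uc.
  have [w] : exists w, w \in nbhd A' (u2 |: B').
    apply: Hext.
    - exact: leq_trans sb (leq_trans bd (leqnSn _)).
    - by rewrite cardsU1; move: aM sa; rewrite -/B'; case: (_ \notin _) => /=; lia.
    - rewrite disjoint_sym disjoint_setU1 disjoint_sym dis andbT inE.
      by apply/negP => /uc; rewrite -{2}[s]negbK emix eqxx.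
  case/nbhdP => wB wA wnB.
  apply: connect_trans (connN w x0 _ x0N); last first.
    apply/nbhdP; split=> // [|c cB]; last by rewrite wnB // inE cB orbT.
    by apply: contra wB => wB; rewrite inE wB orbT.
  apply: connect1; rewrite emix W_nbhd ?andbT.
    rewrite wnB ?inE ?eqxx // andbT.
    by apply: contraNneq wB => ->; rewrite setU11.
  apply/nbhdP; split=> // [|c cB]; last by rewrite wnB // inE cB orbT.
  by apply: contra wB => wB; rewrite inE wB orbT.
have u1E : u1 = ~~ s by exact: negb_of_neq.
subst u1; move/common_nbrP: (uW) => uc.
have [w] : exists w, w \in nbhd (u2 |: A') B'.
  apply: Hext => //.
  - by rewrite cardsU1; move: bd sb; rewrite -/A'; case: (_ \notin _) => /=; lia.
  - rewrite disjoint_setU1 dis andbT inE.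
    by apply/negP => /uc; rewrite emix eqxx.
case/nbhdP => wB wA wnB.
have wN : w \in nbhd A' B'.
  by apply/nbhdP; split=> // c cA; apply: wA; rewrite inE cA orbT.
apply: connect_trans (connN w x0 wN x0N).
by apply: connect1; rewrite W_nbhd // esame // wA // setU11.
Qed.

(** Every step is charged to the sign counted by [b], which grows by two per dimension and must end
    at [d] or less to reach [links_acyclic1]. *)
Lemma links_acyclic_small s i a b :
  (b + i.*2 <= d)%N -> (a + d + 3 <= M)%N -> links_acyclic s i.+1 a b.
Proof.
elim: i b => [|i IHi] b hb hM; first by apply: links_acyclic1; lia.
rewrite -[s]negbK; apply: links_acyclicN; apply: links_acyclic_step; [lia|lia|].
by apply: links_acyclicN; apply: IHi => //; lia.
Qed.

(** Steps are charged to the sign counted by [a] until the dimensions that remain fit the other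
    sign, whose side of [A] is still empty. At the switch [a] is at most [2 * d + 2], so [3 * d + 8]
    covers the [a + d + 3] that is asked for there. *)
Lemma links_acyclic_one_sided s i a :
  (a + i.*2 <= d.+1.*2)%N -> (3 * d + 8 <= M)%N -> links_acyclic s i.+1 a 0.
Proof.
move=> + hM; elim: i a => [|i IHi] a ha.
  by apply: links_acyclic_small; lia.
(* The place of the switch. Before it, [i.+1.*2 > d] and the budget for [a] together force
   [a <= d.+1], as the step demands. *)
have [id|id] := leqP i.+1.*2 d; first by apply: links_acyclic_small; lia.
apply: links_acyclic_step; [lia|lia|].
by apply: IHi; lia.
Qed.

Lemma sep_rel_admissible : admissible sep_rel.
Proof.
split=> [[a x] [b y]|[a x]|s x y|s x y gxy]; rewrite /sep_rel /=.
- by rewrite (eq_sym b) (eq_sym y) (gsym y).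
- by rewrite eqxx girr.
- by case: s.
- by rewrite eqxx.
Qed.

Lemma sep_acyclic i : (3 * d + 8 <= M)%N -> (i <= d.+1)%N ->
  acyclic (clique sep_rel setT) i.+1.
Proof.
move=> hM id.
have -> : setT = common_nbr sep_rel set0.
  by apply/setP => x; rewrite !inE; apply/esym/forall_inP => c; rewrite inE.
have s0 s : side s set0 = set0 by apply/setP => x; rewrite !inE.
apply: (@links_acyclic_one_sided true i 0); rewrite ?s0 ?cards0 //; first by lia.
  exact: sep_rel_admissible.
by move=> s x; rewrite inE.
Qed.

(** * The involution and its antipodal chains *)

Definition flip (x : T) : T := (~~ x.1, x.2).

Lemma flipK : involutive flip.
Proof. by case=> a x; rewrite /flip /= negbK. Qed.

Lemma imset_flipK : involutive (fun s : {set T} => flip @: s).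
Proof.
move=> s; apply/setP => x; rewrite -{1}[x]flipK (mem_imset _ _ (can_inj flipK)).
by rewrite -{1}[x]flipK flipK (mem_imset _ _ (can_inj flipK)).
Qed.

Lemma mem_imset_flip x (s : {set T}) : (x \in flip @: s) = (flip x \in s).
Proof. by rewrite -{1}[x]flipK (mem_imset _ _ (can_inj flipK)). Qed.

Lemma bnd_flip (z : {set T} -> 'F_2) s :
  bnd (fun s => z (flip @: s)) s = bnd z (flip @: s).
Proof.
rewrite /bnd [RHS](reindex_inj (can_inj flipK)); apply: eq_big => x.
  by rewrite mem_imset_flip flipK.
by move=> _; rewrite imsetU1.
Qed.

Lemma clique_flip (s : {set T}) : clique sep_rel setT (flip @: s) = clique sep_rel setT s.
Proof.
suff h t : clique sep_rel setT t -> clique sep_rel setT (flip @: t).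
  by apply/idP/idP => [/h|/h //]; rewrite imset_flipK.
move=> /cliqueP[_ te]; apply/cliqueP; split=> [x _|x y]; first by rewrite inE.
rewrite !mem_imset_flip => xt yt xy.
have := te _ _ xt yt; rewrite (can_eq flipK) => /(_ xy).
case: x y {xt yt xy} => [a x] [b y]; rewrite /sep_rel /=.
by case: a b => [] [].
Qed.

(* An equivariant chain map from the sphere of dimension [m] with its antipodal
   cell structure. *)
Definition antipodal_chains m (c : nat -> {set T} -> 'F_2) :=
  [/\ forall j, (j <= m)%N -> chain_on (clique sep_rel setT) j.+1 (c j),
      forall j s, (j < m)%N -> bnd (c j.+1) s = c j s + c j (flip @: s)
    & exists x, c 0 = point_chain x].

(** The chain [c m] plus its flip is a cycle: its boundary contains [c m.-1] and the flip of it
    twice each. For [m = 0] it is a pair of vertices, whose augmented boundaries cancel. Acyclicity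
    then fills it. *)
Lemma antipodal_chains_exist : (3 * d + 8 <= M)%N ->
  exists c, antipodal_chains d.+2 c.
Proof.
move=> hM.
have [w0 _] : exists w, w \in nbhd set0 set0.
  by apply: Hext; rewrite ?cards0 // -setI_eq0 setI0.
have pt_on x : chain_on (clique sep_rel setT) 1 (point_chain x).
  move=> s; rewrite /point_chain; case: (eqVneq s [set x]) => [-> _|_]; last by rewrite eqxx.
  rewrite cards1; split=> //; apply/cliqueP; split=> [y|y y']; first by rewrite inE.
  by rewrite !inE => /eqP-> /eqP->; rewrite eqxx.
suff: forall m, (m <= d.+2)%N -> exists c, antipodal_chains m c by apply.
elim=> [|m IHm] hm.
  exists (fun=> point_chain (true, w0)); split=> // [j|]; last by exists (true, w0).
  by rewrite leqn0 => /eqP->; apply: pt_on.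
have [c [con cb [x c0]]] := IHm (ltnW hm).
have on_flip : chain_on (clique sep_rel setT) m.+1 (fun s => c m (flip @: s)).
  move=> s /(con m (leqnn m))[]; rewrite clique_flip => cl <-; split=> //.
  by rewrite (card_imset _ (can_inj flipK)).
have [w hw wb] : exists2 w, chain_on (clique sep_rel setT) m.+2 w &
    bnd w =1 (fun s => c m s + c m (flip @: s)).
  apply: sep_acyclic => //; first by apply: chain_onD => //; apply: con.
  move=> s; rewrite bndD bnd_flip.
  case: m cb {IHm hm con on_flip} => [|m] cb; last first.
    by rewrite !cb // imset_flipK [X in _ + X]addrC F2_addxx.
  have h1 (y : T) (t : {set T}) : bnd (point_chain y) t = (t == set0)%:R :> 'F_2.
    have [->|t0] := eqVneq t set0.
      rewrite /bnd (bigD1 y) ?inE //= setU0 /point_chain eqxx big1 ?addr0 // => a /andP[_ ay].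
      by rewrite setU0 (inj_eq set1_inj) (negbTE ay).
    apply: big1 => a at_; rewrite /point_chain; case: eqP => // E0.
    have := congr1 (fun s : {set T} => #|s|) E0.
    rewrite /= cardsU1 at_ cards1 add1n => -[] /eqP; rewrite cards_eq0 => /eqP E.
    by rewrite E eqxx in t0.
  rewrite c0 !h1 -[s == set0](inj_eq (can_inj imset_flipK)) imset0.
  exact: F2_addxx.
exists (fun j => if (j == m.+1)%N then w else c j); split.
- move=> j; rewrite leq_eqVlt ltnS; have [->|_] := eqVneq j m.+1; first by [].
  exact: con.
- move=> j s; rewrite ltnS eqSS leq_eqVlt; have [->|jm] := eqVneq j m.
    by rewrite (ltn_eqF (ltnSn m)) wb.
  move=> /= jm'; by rewrite (ltn_eqF (leqW jm')) cb.
- by exists x.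
Qed.

End SeparatedJoin.

(* [cobnd f t] is the sum of [f] over the sequences obtained by deleting one
   entry of [t]. *)
Fixpoint cobnd (T : Type) (f : seq T -> 'F_2) (t : seq T) : 'F_2 :=
  if t is x :: t' then f t' + cobnd (fun s => f (x :: s)) t' else 0.

Section Cobnd.
Variable T : eqType.
Implicit Types (f g : seq T -> 'F_2) (t u : seq T).

Lemma eq_cobnd f g t :
  (forall u, subseq u t -> (size u).+1 = size t -> f u = g u) ->
  cobnd f t = cobnd g t.
Proof.
elim: t f g => //= x t IH f g fg; congr (_ + _); first by apply: fg => //; apply: subseq_cons.
apply: IH => u ut su; apply: fg; first by rewrite /= eqxx.
by rewrite /= su.
Qed.

Lemma cobndD f g t : cobnd (fun s => f s + g s) t = cobnd f t + cobnd g t.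
Proof.
by elim: t f g => /= [|x t IH] f g; rewrite ?addr0 // IH addrACA.
Qed.

Lemma cobnd_const0 t : cobnd (fun=> 0) t = 0.
Proof. by elim: t => //= x t ->; rewrite addr0. Qed.

Lemma cobnd_cobnd f t : cobnd (cobnd f) t = 0.
Proof.
elim: t f => //= x t IH f.
by rewrite cobndD IH addr0 F2_addxx.
Qed.

Lemma cobnd_rem f t : (forall u u', perm_eq u u' -> f u = f u') ->
  cobnd f t = \sum_(x <- t) f (rem x t).
Proof.
elim: t f => [|x t IH] f fperm /=; first by rewrite big_nil.
rewrite big_cons /= eqxx IH; last by move=> u u' uu'; apply: fperm; rewrite perm_cons.
congr (_ + _); rewrite !big_seq; apply: eq_bigr => y yt; apply: fperm.
by case: (eqVneq x y) => [xy|//]; rewrite perm_sym xy perm_to_rem.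
Qed.

Lemma cobnd_perm f t t' : (forall u u', perm_eq u u' -> f u = f u') ->
  perm_eq t t' -> cobnd f t = cobnd f t'.
Proof.
move=> fperm tt'; rewrite !cobnd_rem // (perm_big _ tt') /=.
rewrite !big_seq; apply: eq_bigr => x xt'; apply: fperm.
rewrite -(perm_cons x) -(permPl (perm_to_rem _)) ?(perm_mem tt') //.
by rewrite (permPl tt') perm_to_rem.
Qed.
End Cobnd.

Lemma cobnd_map (T U : Type) (h : T -> U) (f : seq U -> 'F_2) t :
  cobnd f (map h t) = cobnd (fun s => f (map h s)) t.
Proof. by elim: t f => //= x t IH f; rewrite IH. Qed.

Lemma cobnd_ext (T : Type) (f g : seq T -> 'F_2) t : f =1 g -> cobnd f t = cobnd g t.
Proof. by elim: t f g => //= x t IH f g fg; rewrite fg (IH _ (fun s => g (x :: s))). Qed.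

(** * Ky Fan's parity count *)

Fixpoint alternates (b : bool) (s : seq bool) :=
  if s is x :: s' then (x == b) && alternates (~~ b) s' else true.

(* The label [2 i + s] stands for the vertex of the cross-polytope on the
   [i]-th axis with sign [s]. *)
Definition opp_label (l : nat) := if odd l then l.-1 else l.+1.

Definition no_opp (s : seq nat) := {in s &, forall x y, y != opp_label x}.

(** The alternating simplices of Ky Fan: in increasing order of labels the signs, which are the
    parities, alternate starting from [b]. Sorting makes this independent of the order of the
    vertices. *)
Definition fan (b : bool) (s : seq nat) : 'F_2 :=
  (alternates b (map odd (sort leq s)))%:R.

(** If a deletion from [s] alternates from [b] but [s] alternates from neither sign, then [s] has
    one pair of equal neighbours and deleting either of them works, which is zero mod 2. A nonempty
    alternating [s] has exactly one such deletion, that of its last or of its first entry according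
    to its initial sign. *)
Lemma cobnd_alternates b s :
  cobnd (fun u => (alternates b u)%:R : 'F_2) s =
  (alternates b s)%:R + (alternates (~~ b) s)%:R.
Proof.
elim: s b => [|x s IH] b; first by rewrite /= F2_addxx.
rewrite /=; have [->|xb] := eqVneq x b => /=.
  rewrite IH negbK (_ : (b == ~~ b) = false) /=; last by case: (b).
  by rewrite addr0 addrCA F2_addxx addr0.
rewrite negbK (_ : (x == ~~ b) = true) /=; last by case: x b xb => [] [].
by rewrite cobnd_const0 addr0 add0r.
Qed.

Lemma fan_perm b s s' : perm_eq s s' -> fan b s = fan b s'.
Proof.
move=> ss'; rewrite /fan; suff -> : sort leq s = sort leq s' by [].
by apply/perm_sortP => //; [exact: leq_total|exact: leq_trans|exact: anti_leq].
Qed.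

Lemma cobnd_fan b s : cobnd (fan b) s = fan b s + fan (~~ b) s.
Proof.
rewrite (@cobnd_perm _ (fan b) s (sort leq s)); last by rewrite perm_sym perm_sort.
  have sS : sorted leq (sort leq s) by apply: sort_sorted; exact: leq_total.
  rewrite /fan -cobnd_alternates cobnd_map; apply: eq_cobnd => u us _.
  by rewrite sorted_sort //; [exact: leq_trans|exact: subseq_sorted leq_trans _ _ us sS].
exact: fan_perm.
Qed.

Lemma alternates_negb b s : alternates b (map negb s) = alternates (~~ b) s.
Proof.
by elim: s b => //= x s IH b; rewrite IH; case: x b => [] [].
Qed.

(** [opp_label] exchanges the two labels on one axis. When no two labels of [s] are opposite it
    preserves their order, and only the parities change. *)
Lemma fan_opp b s : no_opp s -> fan b (map opp_label s) = fan (~~ b) s.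
Proof.
move=> no; rewrite /fan.
have -> : sort leq (map opp_label s) = map opp_label (sort leq s).
  apply: (@sorted_eq _ leq); [exact: leq_trans|exact: anti_leq| | |].
  - by apply: sort_sorted; exact: leq_total.
  - rewrite sorted_map; apply: (@sub_in_sorted _ (mem s) leq).
    + move=> x y xs ys xy; have := no x y xs ys; rewrite /= /opp_label.
      by case: (boolP (odd x)); case: (boolP (odd y)); lia.
    + by apply/allP => x; rewrite mem_sort.
    + by apply: sort_sorted; exact: leq_total.
  - by rewrite perm_sort perm_map // perm_sym perm_sort.
rewrite -alternates_negb -!map_comp.
rewrite (@eq_map _ _ (odd \o opp_label) (negb \o odd)) // => x.
by rewrite /= /opp_label; case: (boolP (odd x)); lia.
Qed.

(** Consecutive labels of an alternating list differ in sign and are not opposite, so they lie on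
    different axes. The axes therefore increase strictly, and there are only [m] of them. *)
Lemma fan_large b m s : no_opp s -> {in s, forall l, (l < m.*2)%N} ->
  (m < size s)%N -> fan b s = 0.
Proof.
move=> no sm ms; rewrite /fan; case: (boolP (alternates _ _)) => // alt.
suff : (size (map half (sort leq s)) <= size (iota 0 m))%N.
  by rewrite size_map size_sort size_iota leqNgt ms.
apply: uniq_leq_size; last first.
  move=> h /mapP[x]; rewrite mem_sort => /sm xm ->; rewrite mem_iota; lia.
apply: (@sorted_uniq _ ltn); [exact: ltn_trans|exact: ltnn|].
have : no_opp (sort leq s) by move=> x y; rewrite !mem_sort; apply: no.
have : sorted leq (sort leq s) by apply: sort_sorted; exact: leq_total.
elim: (sort leq s) b alt => //= x [|y l] IH b //=.
case/and3P=> /eqP xb /eqP yb alt /andP[xy sS] nol.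
have /= -> : sorted ltn (map half (y :: l)).
  apply: (IH (~~ b)) => //=; first by rewrite yb eqxx.
  by move=> u v us vs; apply: nol; rewrite inE ?us ?vs orbT.
have := nol x y; rewrite !inE !eqxx orbT => /(_ isT isT).
rewrite /opp_label andbT; have : odd x != odd y by rewrite xb yb; case: (b).
by case: (boolP (odd x)); case: (boolP (odd y)); lia.
Qed.

Lemma fan1 l : fan true [:: l] + fan false [:: l] = 1.
Proof. by rewrite /fan /=; case: (odd l); apply/val_inj. Qed.

(** * Barycentric subdivision *)

(** The step is [(1 - x) * (1 + (k + 1) * x) <= 1 + k * x]. The bound serves twice: for the mesh of
    iterated subdivisions and for the chance that a set has a given vertex as a neighbour. *)
Lemma expr_onem_le (R : realFieldType) (x : R) k : 0 <= x -> x <= 1 ->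
  (1 - x) ^+ k * (1 + k%:R * x) <= 1.
Proof.
move=> x0 x1; elim: k => [|k IH]; first by rewrite expr0 mul0r addr0 mul1r.
apply: le_trans IH; rewrite exprSr -mulrA ler_wpM2l ?exprn_ge0 ?subr_ge0 //.
rewrite -natr1; have : 0 <= (k%:R : R) by []; nra.
Qed.


Section Subdivision.
Variables (R : realType) (P : normedModType R).
Implicit Types (f g : seq P -> 'F_2) (s t u : seq P).

Definition bary t : P := (size t)%:R^-1 *: \sum_(x <- t) x.

(* [subdiv n f t] is the sum of [f] over the simplices of the barycentric
   subdivision of the simplex [t] with [n] vertices. *)
Fixpoint subdiv n f t : 'F_2 :=
  if n is m.+1 then cobnd (fun u => subdiv m (fun s => f (bary t :: s)) u) t
  else f [::].

Lemma subdiv_ext n f g t : f =1 g -> subdiv n f t = subdiv n g t.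
Proof.
elim: n f g t => [|n IH] f g t fg /=; first exact: fg.
by apply: cobnd_ext => u; apply: IH => s; apply: fg.
Qed.

Lemma subdivD n f g t : subdiv n (fun s => f s + g s) t = subdiv n f t + subdiv n g t.
Proof.
elim: n f g t => [//|n IH] f g t /=.
by rewrite -cobndD; apply: cobnd_ext => u; rewrite IH.
Qed.

(** Dually, subdivision is a chain map. Deleting the leading barycentre from the simplices of the
    subdivision gives the subdivided boundary. The other deletions add up, by induction, to a double
    [cobnd], which vanishes. *)
Lemma cobnd_subdiv n f t : cobnd (subdiv n f) t = subdiv n.+1 (cobnd f) t.
Proof.
elim: n f t => [|n IH] f t.
  by apply: cobnd_ext => u /=; rewrite addr0.
rewrite [RHS](_ : _ = cobnd (subdiv n.+1 f) t +
    cobnd (subdiv n.+1 (cobnd (fun s => f (bary t :: s)))) t); last first.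
  by rewrite -cobndD; apply: cobnd_ext => u; rewrite -subdivD.
rewrite -[LHS]addr0; congr (_ + _).
rewrite (@cobnd_ext _ _ (cobnd (subdiv n (fun s => f (bary t :: s))))) ?cobnd_cobnd //.
Qed.

Lemma subdiv_perm n f t t' : perm_eq t t' -> subdiv n f t = subdiv n f t'.
Proof.
elim: n f t t' => [//|n IH] f t t' tt' /=.
have -> : bary t' = bary t by rewrite /bary (perm_size tt') (perm_big _ tt').
by apply: cobnd_perm tt' => u u'; apply: IH.
Qed.

Lemma subdiv_map n f (h : P -> P) t :
  (forall u, bary (map h u) = h (bary u)) ->
  subdiv n f (map h t) = subdiv n (fun s => f (map h s)) t.
Proof.
move=> hb; elim: n f t => [//|n IH] f t /=.
by rewrite cobnd_map hb; apply: cobnd_ext => u; rewrite IH.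
Qed.

(** The closure under barycentres, encoded impredicatively. It contains the vertices of all iterated
    subdivisions, and a property stable under barycentres passes from [t] to it by instantiating
    [Q]. *)
Definition hull t (y : P) := forall Q : P -> Prop,
  (forall x, x \in t -> Q x) ->
  (forall u, u != [::] -> (forall x, x \in u -> Q x) -> Q (bary u)) -> Q y.

Lemma hull_trans t u y : (forall x, x \in u -> hull t x) -> hull u y -> hull t y.
Proof. by move=> ut uy Q Qt Qb; apply: uy => // x xu; apply: ut. Qed.

Lemma hull_self t x : x \in t -> hull t x.
Proof. by move=> xt Q Qt _; apply: Qt. Qed.

Definition small (D : R) t := forall x y, x \in t -> y \in t -> `|x - y| <= D.

Lemma bary_dist t (b : P) (r : R) : t != [::] ->
  (forall x, x \in t -> `|b - x| <= r) -> `|b - bary t| <= r.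
Proof.
move=> t0 h.
have st : (0 : R) < (size t)%:R by rewrite ltr0n lt0n size_eq0.
have -> : b - bary t = (size t)%:R^-1 *: \sum_(x <- t) (b - x).
  rewrite sumrB scalerBr big_const_seq count_predT iter_addr addr0.
  by rewrite -[b *+ _]scaler_nat scalerA mulVf ?scale1r // gt_eqF.
rewrite normrZ [X in X * _]ger0_norm ?invr_ge0 ?(ltW st) // ler_pdivrMl //.
apply: le_trans (ler_norm_sum _ _ _) _.
rewrite mulr_natl -[X in r *+ X](count_predT t) -iter_addr_0 -big_const_seq.
by rewrite big_seq [leRHS]big_seq; apply: ler_sum => x xt; apply: h.
Qed.

(** In the average of [x - y] over [y] in [t], the term of [x] itself is zero. This leaves the
    factor [(size t - 1) / size t], which increases with the size. *)
Lemma bary_vertex_dist t x D N : x \in t -> small D t -> (size t <= N.+1)%N ->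
  `|x - bary t| <= N%:R / N.+1%:R * D.
Proof.
move=> xt hD sN.
have D0 : 0 <= D by have := hD x x xt xt; rewrite subrr normr0.
have st0 : (0 < size t)%N by case: (t) xt.
have st : (0 : R) < (size t)%:R by rewrite ltr0n.
have -> : x - bary t = (size t)%:R^-1 *: \sum_(y <- rem x t) (x - y).
  have -> : \sum_(y <- rem x t) (x - y) = \sum_(y <- t) (x - y).
    by rewrite (big_rem x xt) /= subrr add0r.
  rewrite sumrB scalerBr big_const_seq count_predT iter_addr addr0.
  by rewrite -[x *+ _]scaler_nat scalerA mulVf ?scale1r // gt_eqF.
rewrite normrZ [X in X * _]ger0_norm ?invr_ge0 ?(ltW st) //.
have -> : N%:R / N.+1%:R * D = (1 - N.+1%:R^-1) * D.
  rewrite (_ : N%:R = N.+1%:R - 1); last by rewrite -natr1 addrK.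
  by rewrite mulrBl mul1r mulfV ?pnatr_eq0.
apply: le_trans (_ : (1 - (size t)%:R^-1) * D <= _); last first.
  by rewrite ler_wpM2r // lerD2l lerN2 lef_pV2 ?posrE ?ltr0n // ler_nat.
have -> : 1 - (size t)%:R^-1 = (size t)%:R^-1 * (size t).-1%:R :> R.
  by rewrite -subn1 natrB // mulrBr mulr1 mulVf ?gt_eqF.
rewrite -mulrA ler_pM2l ?invr_gt0 //.
apply: le_trans (ler_norm_sum _ _ _) _.
rewrite -(size_rem xt) mulr_natl -[X in D *+ X](count_predT (rem x t)) -iter_addr_0 -big_const_seq.
rewrite big_seq [leRHS]big_seq; apply: ler_sum => y yt; apply: hD => //.
exact: mem_rem yt.
Qed.

(** The subdivision exists only as the summation operator [subdiv], so the mesh estimate is stated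
    as a congruence: it is enough to compare [f] and [g] on small simplices in the hull. *)
Lemma eq_subdiv N D n f g t : (n <= N.+1)%N -> size t = n -> small D t ->
  (forall s, size s = n -> (forall y, y \in s -> hull t y) ->
    small (N%:R / N.+1%:R * D) s -> f s = g s) ->
  subdiv n f t = subdiv n g t.
Proof.
elim: n f g t => [|n IH] f g t nN st tD fg /=; first by apply: fg.
apply: eq_cobnd => u ut su.
have sut : {subset u <= t} := mem_subseq ut.
apply: IH => [||x y xu yu|s ss sh sD]; first exact: ltnW.
- by move: su; rewrite st => -[].
- by apply: tD; apply: sut.
have t0 : t != [::] by rewrite -size_eq0 st.
have hb y : y \in s -> `|bary t - y| <= N%:R / N.+1%:R * D.
  move=> /sh /(_ (fun z => `|bary t - z| <= N%:R / N.+1%:R * D)); apply.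
    by move=> x xu; rewrite distrC; apply: bary_vertex_dist; rewrite ?st ?sut.
  by move=> v v0 hv; apply: bary_dist.
apply: fg => [|y|x y]; first by rewrite /= ss.
- rewrite inE => /orP[/eqP->|/sh ys]; first by move=> Q Qt Qb; apply: Qb.
  by apply: hull_trans ys => x xu; exact: hull_self (sut _ xu).
have D0 : 0 <= N%:R / N.+1%:R * D.
  have [x0 x0t] : exists x, x \in t by case: (t) t0 => // a l _; exists a; rewrite inE eqxx.
  have := tD x0 x0 x0t x0t; rewrite subrr normr0 => D0.
  by rewrite mulr_ge0 // divr_ge0.
rewrite !inE => /orP[/eqP->|xs] /orP[/eqP->|ys].
- by rewrite subrr normr0.
- exact: hb.
- by rewrite distrC; apply: hb.
- exact: sD.
Qed.

Definition subdivs k n f := iter k (subdiv n) f.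

Lemma subdivs_ext k n f g t : f =1 g -> subdivs k n f t = subdivs k n g t.
Proof.
move=> fg; elim: k t => [|k IH] t /=; first exact: fg.
by apply: subdiv_ext.
Qed.

Lemma subdivsD k n f g t :
  subdivs k n (fun s => f s + g s) t = subdivs k n f t + subdivs k n g t.
Proof.
elim: k t => [//|k IH] t /=; rewrite -subdivD; exact: subdiv_ext.
Qed.

Lemma cobnd_subdivs k n f t : cobnd (subdivs k n f) t = subdivs k n.+1 (cobnd f) t.
Proof.
elim: k t => [//|k IH] t /=; rewrite cobnd_subdiv; exact: subdiv_ext.
Qed.

Lemma subdivs_perm k n f t t' : (forall u u', perm_eq u u' -> f u = f u') ->
  perm_eq t t' -> subdivs k n f t = subdivs k n f t'.
Proof. by move=> fp; case: k => [|k]; [exact: fp|exact: subdiv_perm]. Qed.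

Lemma subdivs_map k n f (h : P -> P) t :
  (forall u, bary (map h u) = h (bary u)) ->
  subdivs k n f (map h t) = subdivs k n (fun s => f (map h s)) t.
Proof.
move=> hb; elim: k t => [//|k IH] t /=.
by rewrite subdiv_map //; apply: subdiv_ext.
Qed.

Lemma eq_subdivs N D k n f g t : (n <= N.+1)%N -> size t = n -> small D t ->
  (forall s, size s = n -> (forall y, y \in s -> hull t y) ->
    small ((N%:R / N.+1%:R) ^+ k * D) s -> f s = g s) ->
  subdivs k n f t = subdivs k n g t.
Proof.
move=> nN; elim: k D t => [|k IH] D t st tD fg /=.
  by apply: fg => // [y|]; [exact: hull_self|rewrite expr0 mul1r].
apply: (@eq_subdiv N D) => // s ss sh sD; apply: (IH _ s ss sD) => v vs vh vD.
apply: fg => // [y /vh|]; first exact: hull_trans.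
by rewrite exprSr -mulrA.
Qed.

Lemma subdivs1 k f x : subdivs k 1 f [:: x] = f [:: x].
Proof.
elim: k => //= k IH; rewrite -[RHS]IH /= addr0.
by rewrite /bary /= big_seq1 invr1 scale1r.
Qed.

End Subdivision.

(** * Parity of alternating simplices in subdivided antipodal chains *)

Section Fan.
Variables (R : realType) (P : normedModType R) (V : finType) (g : rel V).
Notation T := (bool * V)%type.
Variables (pt : T -> P) (inv : P -> P) (K : P -> Prop) (label : P -> nat).
Variables (m : nat) (c : nat -> {set T} -> 'F_2) (delta : R).
Hypotheses (inv_bary : forall u, bary (map inv u) = inv (bary u))
  (pt_flip : forall x, pt (flip x) = inv (pt x))
  (hullK : forall s y, clique (sep_rel g) setT s -> hull (map pt (enum s)) y -> K y)
  (label_inv : forall x, K x -> label (inv x) = opp_label (label x))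
  (label_lt : forall x, K x -> (label x < m.*2)%N)
  (label_near : forall x y, K x -> K y -> `|x - y| < delta -> label y != opp_label (label x))
  (delta0 : 0 < delta).

(** In each dimension [j <= m] the subdivided [c j] has an odd number of alternating simplices of
    the two initial signs together. Going from [j] to [j.+1], [cobnd_fan] moves the count to
    [bnd (c j.+1)], that is to [c j] and its flip, and the flip exchanges the initial signs. In
    dimension [m] there are [m + 1] vertices on [m] axes, so the count is zero. *)
Lemma no_antipodal_chains : ~ antipodal_chains g m c.
Proof.
move=> [con cb [x0 c0]].
pose D := \sum_(x : T) \sum_(y : T) `|pt x - pt y|.
pose r : R := m%:R / m.+1%:R.
have [k kD] : exists k, r ^+ k * D < delta.
  have D0 : 0 <= D by apply: sumr_ge0 => x _; apply: sumr_ge0.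
  have rE : r = 1 - m.+1%:R^-1.
    rewrite /r (_ : m%:R = m.+1%:R - 1); last by rewrite -natr1 addrK.
    by rewrite mulrBl mul1r mulfV ?pnatr_eq0.
  have x1 : m.+1%:R^-1 <= 1 :> R by rewrite invf_le1 ?ltr0n // ler1n.
  (* By [expr_onem_le] at [1 / (m + 1)], [r ^+ k * D] is at most [D / (1 + k / (m + 1))], which is
     below [delta] once [k > y]. *)
  pose y := D * m.+1%:R / delta.
  have y0 : 0 <= y by rewrite /y divr_ge0 ?mulr_ge0 // ltW.
  exists (Num.trunc y).+1; set k := (Num.trunc y).+1.
  have yk : y < k%:R by case/andP: (trunc_itv y0).
  have := @expr_onem_le R _ k (ltW _) x1; rewrite -rE invr_gt0 ltr0n => /(_ isT) le1.
  have yD : D < delta * (1 + k%:R * m.+1%:R^-1).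
    rewrite mulrDr mulr1; apply: lt_le_trans (_ : delta * (k%:R * m.+1%:R^-1) <= _); last first.
      by rewrite lerDr ltW.
    by rewrite mulrA ltr_pdivlMr ?ltr0n // [ltRHS]mulrC -ltr_pdivrMr.
  have pos : 0 < 1 + k%:R * m.+1%:R^-1 :> R.
    by rewrite ltr_wpDr // mulr_ge0 ?invr_ge0 ?ler0n.
  rewrite -(ltr_pM2r pos); apply: le_lt_trans yD.
  by rewrite mulrAC ler_piMl.
pose fanp b (t : seq P) := fan b (map label t).
pose F j b (s : {set T}) := subdivs k j.+1 (fanp b) (map pt (enum s)).
have fanp_perm b u u' : perm_eq u u' -> fanp b u = fanp b u'.
  by move=> uu'; apply: fan_perm; apply: perm_map.
have smallD (s : {set T}) : small D (map pt (enum s)).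
  move=> _ _ /mapP[x _ ->] /mapP[y _ ->].
  rewrite /D (bigD1 x) //= (bigD1 y) //= -addrA lerDl addr_ge0 ?sumr_ge0 // => z _.
  by rewrite sumr_ge0.
(* The mesh is below [delta], so identities between counts need checking only on simplices without
   opposite labels. *)
have good_eq j s f1 f2 : (j <= m)%N -> c j s != 0 ->
    (forall u, size u = j.+1 -> (forall y, y \in u -> K y) -> no_opp (map label u) -> f1 u = f2 u) ->
    subdivs k j.+1 f1 (map pt (enum s)) = subdivs k j.+1 f2 (map pt (enum s)).
  move=> jm cjs f12; have [cls sj] := con j jm s cjs.
  apply: (@eq_subdivs _ _ m D) => //; first by rewrite size_map -cardE.
  move=> u su uh uD; apply: f12 => // [y /uh|]; first exact: hullK.
  move=> _ _ /mapP[x xu ->] /mapP[y yu ->]; apply: label_near.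
  - by apply: (hullK cls); apply: uh.
  - by apply: (hullK cls); apply: uh.
  - by apply: le_lt_trans kD; apply: uD.
have F_cobnd j (s : {set T}) : cobnd (subdivs k j.+1 (fanp true)) (map pt (enum s)) = \sum_(x in s) F j true (s :\ x).
  rewrite cobnd_map cobnd_rem.
    rewrite big_enum /=; apply: eq_bigr => x xs; rewrite /F.
    apply: subdivs_perm; first exact: fanp_perm.
    apply: perm_map; apply: uniq_perm; rewrite ?rem_uniq ?enum_uniq // => y.
    by rewrite mem_rem_uniq ?enum_uniq // !inE !mem_enum !inE.
  by move=> u u' uu'; apply: subdivs_perm; [exact: fanp_perm|exact: perm_map].
have F_flip j s : (j <= m)%N -> c j s != 0 -> F j true ((@flip V) @: s) = F j false s.
  move=> jm cjs; rewrite /F.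
  rewrite (@subdivs_perm _ _ _ _ _ _ (map inv (map pt (enum s)))); last first.
  - rewrite -map_comp (@eq_map _ _ (inv \o pt) (pt \o @flip V)); last by move=> x /=; rewrite pt_flip.
    rewrite map_comp; apply: perm_map; apply: uniq_perm; rewrite ?enum_uniq //.
      by rewrite map_inj_uniq ?enum_uniq //; exact: can_inj (@flipK V).
    move=> y; rewrite mem_enum mem_imset_flip -[y in RHS]flipK.
    by rewrite mem_map ?mem_enum //; exact: can_inj (@flipK V).
  - exact: fanp_perm.
  rewrite subdivs_map //; apply: good_eq => // u su uK uno.
  rewrite /fanp -map_comp -[false]/(~~ true) -fan_opp // -map_comp; congr fan.
  by apply/eq_in_map => y /uK yK /=; rewrite label_inv.
suff tot j : (j <= m)%N -> \sum_s c j s * (F j true s + F j false s) = 1.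
  have := tot m (leqnn m); rewrite big1 => [/esym/eqP|s _]; first by rewrite oner_eq0.
  have [->|cs] := eqVneq (c m s) 0; first by rewrite mul0r.
  rewrite -subdivsD (@good_eq m s _ (fun=> 0)) //.
    suff -> : subdivs k m.+1 (fun=> 0) (map pt (enum s)) = 0 by rewrite mulr0.
    rewrite -[RHS](F2_addxx (subdivs k m.+1 (fun=> 0) (map pt (enum s)))) -subdivsD.
    by apply: subdivs_ext => u; rewrite addr0.
  move=> u su uK uno; rewrite /fanp !(@fan_large _ m) ?addr0 ?size_map ?su //.
  - by move=> _ /mapP[y /uK yK ->]; apply: label_lt.
  - by move=> _ /mapP[y /uK yK ->]; apply: label_lt.
elim: j => [|j IH] jm.
  rewrite (bigD1 [set x0]) //= big1 => [|s sx]; last by rewrite c0 /point_chain (negbTE sx) mul0r.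
  rewrite c0 /point_chain eqxx mul1r addr0 /F enum_set1 /= !subdivs1.
  exact: fan1.
rewrite -[RHS](IH (ltnW jm)).
transitivity (\sum_s c j.+1 s * \sum_(x in s) F j true (s :\ x)).
  apply: eq_bigr => s _; have [->|cs] := eqVneq (c j.+1 s) 0; first by rewrite !mul0r.
  congr (_ * _); rewrite -F_cobnd cobnd_subdivs -subdivsD; apply: good_eq => // u _ _ _.
  by rewrite /fanp -cobnd_fan cobnd_map.
(* Pairs of a face and one of its facets are regrouped by the facet [u]. *)
transitivity (\sum_u bnd (c j.+1) u * F j true u).
  under eq_bigr do rewrite mulr_sumr.
  under [RHS]eq_bigr do rewrite mulr_suml.
  rewrite (exchange_big_dep predT) //= [RHS](exchange_big_dep predT) //=.
  apply: eq_bigr => x _.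
  rewrite (reindex_onto (fun u => x |: u) (fun s => s :\ x)) => [|s xs]; last exact: setD1K.
  apply: eq_big => [u|u /andP[_ /eqP uE]]; last by rewrite uE.
  rewrite setU11 /=; apply/eqP/idP => [<-|xu]; first by rewrite !inE eqxx.
  exact: setU1K.
under eq_bigr do rewrite cb // mulrDl.
rewrite big_split /=; under [RHS]eq_bigr do rewrite mulrDr.
rewrite [RHS]big_split /=; congr (_ + _).
rewrite (reindex_inj (can_inj (@imset_flipK V))) /=; apply: eq_bigr => s _.
rewrite imset_flipK; have [->|cs] := eqVneq (c j s) 0; first by rewrite !mul0r.
by rewrite F_flip // ltnW.
Qed.
End Fan.

(** * Independent random subsets *)

Section RandomSubset.
Variables (R : realFieldType) (I : finType) (p : R).
Implicit Types (l : seq I) (f g : {set I} -> R) (D : {set I}).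

(* The expectation of [f E] when [E] contains each entry of [l] independently
   with probability [p]. *)
Fixpoint expect l f : R :=
  if l is e :: l' then p * expect l' (fun E => f (e |: E)) + (1 - p) * expect l' f
  else f set0.

Lemma expect_sum l f : uniq l ->
  expect l f = \sum_(E : {set I} | E \subset [set x in l])
    f E * \prod_(e <- l) (if e \in E then p else 1 - p).
Proof.
elim: l f => [|e l IH] f /=.
  rewrite (big_pred1 set0) ?big_nil ?mulr1 // => E.
  by rewrite /= -subset0; congr (_ \subset _); apply/setP => x; rewrite !inE.
case/andP=> el ul; rewrite !IH // !mulr_sumr.
rewrite [RHS](bigID (fun E : {set I} => e \in E)) /=; congr (_ + _).
  rewrite [RHS](reindex_onto (fun E => e |: E) (fun E => E :\ e)) /=; last first.
    by move=> E /= /andP[_ eE]; rewrite setD1K.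
  apply: eq_big => [E|E El].
    rewrite setU11 andbT; apply/idP/andP => [El|[El /eqP <-]].
      split; last by rewrite setU1K //; apply: contra el => /(subsetP El); rewrite inE.
      apply/subsetP => x; rewrite !inE => /orP[->//|/(subsetP El)].
      by rewrite inE => ->; rewrite orbT.
    apply/subsetP => x; rewrite !inE => /andP[xe]; rewrite (negbTE xe) /= => xE.
    by have := subsetP El x; rewrite !inE xE (negbTE xe) orbT => /(_ isT).
  rewrite big_cons setU11 mulrCA; congr (_ * (_ * _)).
  rewrite !big_seq; apply: eq_bigr => x xl; rewrite !inE.
  by case: eqVneq => // xe; rewrite xe (negbTE el) in xl.
apply: eq_big => [E|E El].
  apply/idP/andP => [El|[El eE]].
    split; last by apply: contra el => /(subsetP El); rewrite inE.
    by apply/subsetP => x /(subsetP El); rewrite !inE => ->; rewrite orbT.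
  apply/subsetP => x xE; have := subsetP El x xE; rewrite !inE.
  by case: eqVneq => // xe; rewrite xe (negbTE eE) in xE.
have eE : e \notin E by apply: contra el => /(subsetP El); rewrite inE.
by rewrite big_cons (negbTE eE) mulrCA.
Qed.

Lemma eq_expect l f g : f =1 g -> expect l f = expect l g.
Proof.
elim: l f g => [|e l IH] f g fg /=; first exact: fg.
by congr (_ * _ + _ * _); apply: IH => // E; apply: fg.
Qed.

Lemma expectC l c : expect l (fun=> c) = c.
Proof. by elim: l => //= e l ->; ring. Qed.

Lemma expectD l f g : expect l (fun E => f E + g E) = expect l f + expect l g.
Proof. by elim: l f g => //= e l IH f g; rewrite !IH; ring. Qed.

Lemma expectB l f g : expect l (fun E => f E - g E) = expect l f - expect l g.
Proof. by elim: l f g => //= e l IH f g; rewrite !IH; ring. Qed.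

Lemma expect_bigsum l (J : Type) (r : seq J) (Q : pred J) (F : J -> {set I} -> R) :
  expect l (fun E => \sum_(j <- r | Q j) F j E) = \sum_(j <- r | Q j) expect l (F j).
Proof.
elim: r => [|j r IH].
  by rewrite big_nil -[RHS](expectC l); apply: eq_expect => E; rewrite big_nil.
rewrite big_cons -IH; case: ifP => Qj; last first.
  by apply: eq_expect => E; rewrite big_cons Qj.
by rewrite -expectD; apply: eq_expect => E; rewrite big_cons Qj.
Qed.

(** Testing insertions is enough, since [expect] builds the random set by inserting entries. *)
Definition depends D f := forall e E, e \notin D -> f (e |: E) = f E.

Lemma dependsM D1 D2 f g : depends D1 f -> depends D2 g ->
  depends (D1 :|: D2) (fun E => f E * g E).
Proof. by move=> h1 h2 e E; rewrite inE negb_or => /andP[e1 e2]; rewrite h1 // h2. Qed.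

Lemma depends1B D f : depends D f -> depends D (fun E => 1 - f E).
Proof. by move=> h e E eD; rewrite h. Qed.

Lemma depends_sub D1 D2 f : D1 \subset D2 -> depends D1 f -> depends D2 f.
Proof.
move=> /subsetP s12 h e E eD; apply: h; apply: contra eD; exact: s12.
Qed.

Lemma depends_prod (J : finType) (Q : {set J}) (D : {set I}) (F : J -> {set I} -> R) :
  (forall j, j \in Q -> depends D (F j)) ->
  depends D (fun E => \prod_(j in Q) F j E).
Proof. by move=> h e E eD; apply: eq_bigr => j jQ; rewrite h. Qed.

Lemma expectM l D1 D2 f g : depends D1 f -> depends D2 g -> [disjoint D1 & D2] ->
  expect l (fun E => f E * g E) = expect l f * expect l g.
Proof.
move=> h1 h2 dis; elim: l f g h1 h2 => //= e l IH f g h1 h2.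
have shift D (k : {set I} -> R) : depends D k -> depends D (fun E => k (e |: E)).
  by move=> h e' E eD; rewrite setUCA h.
rewrite !IH //; try exact: shift.
have [e1|e1] := boolP (e \in D1).
  rewrite (@eq_expect l (fun E => g (e |: E)) g) ?mulrDl ?mulrA; first by ring.
  by move=> E; apply: h2; rewrite (disjointFr dis e1).
rewrite (@eq_expect l (fun E => f (e |: E)) f); first by ring.
by move=> E; apply: h1.
Qed.

Lemma expect_prod l (J : finType) (Q : {set J}) (D : J -> {set I}) (F : J -> {set I} -> R) :
  (forall j, j \in Q -> depends (D j) (F j)) ->
  (forall i j, i \in Q -> j \in Q -> i != j -> [disjoint D i & D j]) ->
  expect l (fun E => \prod_(j in Q) F j E) = \prod_(j in Q) expect l (F j).
Proof.
move=> hF hD; have [m] := ubnP #|Q|; elim: m Q hF hD => // m IH Q hF hD Qm.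
have [Q0|[i iQ]] := set_0Vmem Q.
  rewrite Q0 big_set0 -[RHS](expectC l); apply: eq_expect => E.
  by rewrite big_set0.
rewrite (big_setD1 i) //= -IH; last first.
- by move: Qm; rewrite (cardsD1 i) iQ.
- by move=> j k; rewrite !inE => /andP[_ jQ] /andP[_ kQ]; apply: hD.
- by move=> j; rewrite inE => /andP[_]; apply: hF.
rewrite -(@expectM l (D i) (\bigcup_(j in Q :\ i) D j)).
- by apply: eq_expect => E; rewrite (big_setD1 i).
- exact: hF.
- apply: depends_prod => j jQ; apply: depends_sub (bigcup_sup j jQ) _.
  by apply: hF; move: jQ; rewrite inE => /andP[].
- rewrite -setI_eq0 -subset0; apply/subsetP => x /setIP[xi /bigcupP[j]].
  rewrite !inE => /andP[ji jQ] xj; have := hD i j iQ jQ; rewrite eq_sym => /(_ ji).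
  by move=> /disjointFr/(_ xi); rewrite xj.
Qed.

Lemma expect_mem l e : e \in l -> uniq l -> expect l (fun E => (e \in E)%:R) = p.
Proof.
have no k : e \notin k -> expect k (fun E => (e \in E)%:R) = 0.
  elim: k => [|e' k IH] /=; first by rewrite inE.
  rewrite inE negb_or => /andP[ee' ek].
  rewrite (@eq_expect k _ (fun E => (e \in E)%:R)) ?IH //; first by ring.
  by move=> E; rewrite !inE (negbTE ee').
elim: l => //= e' l IH; rewrite inE => /orP[/eqP<-|el] /andP[e'l ul].
  rewrite no // (@eq_expect l _ (fun=> 1)) ?expectC; first by ring.
  by move=> E; rewrite setU11.
rewrite (@eq_expect l _ (fun E => (e \in E)%:R)) ?IH //; first by ring.
by move=> E; rewrite !inE; case: eqVneq => // ee'; rewrite -ee' el in e'l.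
Qed.

Hypotheses (p0 : 0 <= p) (p1 : p <= 1).

Lemma le_expect l f g : (forall E, f E <= g E) -> expect l f <= expect l g.
Proof.
elim: l f g => [|e l IH] f g fg /=; first exact: fg.
by rewrite lerD // ler_wpM2l ?subr_ge0 //; apply: IH.
Qed.
End RandomSubset.

Lemma sum_subsets (R : comPzSemiRingType) (I : finType) (y : R) :
  \sum_(S : {set I}) y ^+ #|S| = (1 + y) ^+ #|I|.
Proof.
rewrite addrC -prodr_const.
rewrite (eq_bigl predT) // (@bigA_distr R 0 1 *%R +%R I (fun=> y) (fun=> 1)).
by apply: eq_bigr => S _; rewrite -prodr_const big_mkcond.
Qed.

(** * Neighbourhoods in the random graph *)

Section GraphExtension.
Variable n : nat.
Notation V := 'I_n.
Implicit Types (E : {set {set V}}) (A B S : {set V}).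

Lemma adjC E u v : adj E u v = adj E v u.
Proof. by rewrite /adj setUC. Qed.

Lemma adj_irr E : is_graph E -> irreflexive (adj E).
Proof.
move=> Eg v; apply/negbTE/negP; rewrite /adj setUid => /(subsetP Eg).
by rewrite inE cards1.
Qed.

Definition hits E (A B : {set V}) (Ss : seq {set V}) w :=
  [&& [forall a in A, adj E w a], [forall b in B, ~~ adj E w b]
    & all (fun S : {set V} => [exists x in S, adj E w x]) Ss].

(** All sets are fixed and [w] lies outside them, so only edges from [w] to these sets matter and
    different [w] are independent. Connectivity of the random set [nbhd (adj E) A B] is recovered
    afterwards by taking components for [S]. *)
Definition one_hit d M s0 E := [forall t : {set V} * {set V} * {set V},
  let A := t.1.1 in let B := t.1.2 in let S := t.2 in
  [&& #|A| <= d, #|B| <= M, 0 < #|S|, #|S| <= s0, [disjoint A & B],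
      [disjoint A & S] & [disjoint B & S]]%N ==>
  [exists w, (w \notin A :|: B :|: S) && hits E A B [:: S] w]].

Definition two_hits d M s0 E := [forall t : {set V} * {set V} * ({set V} * {set V}),
  let A := t.1.1 in let B := t.1.2 in let S := t.2.1 in let S' := t.2.2 in
  [&& #|A| <= d, #|B| <= M, #|S| == s0, #|S'| == s0, [disjoint A & B],
      [disjoint A & S :|: S'], [disjoint B & S :|: S'] & [disjoint S & S']]%N ==>
  [exists w, (w \notin A :|: B :|: (S :|: S')) && hits E A B [:: S; S'] w]].

Lemma hits_nbhd E A B Ss w : hits E A B Ss w -> w \notin B -> w \in nbhd (adj E) A B.
Proof.
case/and3P=> /forall_inP hA /forall_inP hB _ wB; apply/nbhdP; split=> // x xs.
  by rewrite adjC hA.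
by rewrite adjC hB.
Qed.

Lemma one_hitP d M s0 E A B S : one_hit d M s0 E ->
  (#|A| <= d)%N -> (#|B| <= M)%N -> (0 < #|S| <= s0)%N -> [disjoint A & B] ->
  [disjoint A & S] -> [disjoint B & S] ->
  exists w, [/\ w \in nbhd (adj E) A B, w \notin S & exists2 x, x \in S & adj E w x].
Proof.
move=> /forallP/(_ (A, B, S))/= /implyP h Ad BM /andP[S0 Ss] AB AS BS.
have /existsP[w /andP[]] : [exists w, (w \notin A :|: B :|: S) && hits E A B [:: S] w].
  by apply: h; rewrite Ad BM S0 Ss AB AS BS.
rewrite !inE !negb_or => /andP[/andP[wA wB] wS] hw; exists w; split=> //.
  exact: hits_nbhd hw wB.
case/and3P: hw => _ _ /= /andP[/existsP[x /andP[xS xw]] _]; by exists x.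
Qed.

(** A singleton [S] prescribes one more neighbour, which turns [d] into [d.+1]. If [A] is empty, [S]
    is any vertex outside [B], and there is one because [M < n]. *)
Lemma hits_extension d M s0 E : (0 < s0)%N -> (M < n)%N ->
  one_hit d M s0 E -> extension_property (adj E) d.+1 M.
Proof.
move=> s00 Mn h1 A B Ad BM AB.
have [A0|[a aA]] := set_0Vmem A.
  have [x xB] : exists x, x \notin B.
    apply/existsP; rewrite -negb_forall; apply: contraL Mn => /forallP Ball.
    rewrite -leqNgt; apply: leq_trans BM; rewrite -{1}(card_ord n).
    by apply/subset_leq_card/subsetP => x _.
  have [||||||w [wN _ _]] := one_hitP (A := A) (B := B) (S := [set x]) h1 => //.
  - by rewrite A0 cards0.
  - by rewrite cards1.
  - by rewrite A0 -setI_eq0 set0I.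
  - by rewrite disjoint_sym disjoints1.
  by exists w.
have [||||||w [/nbhdP[wB wA wnB] _ [x /set1P->] wa]] :=
    one_hitP (A := A :\ a) (B := B) (S := [set a]) h1 => //.
- by move: Ad; rewrite (cardsD1 a) aA.
- by rewrite cards1.
- by apply: disjointWl AB; apply: subD1set.
- by rewrite disjoint_sym disjoints1 !inE eqxx.
- by rewrite disjoint_sym disjoints1 (disjointFr AB aA).
exists w; apply/nbhdP; split=> // y yA; have [->|ya] := eqVneq y a; first by rewrite adjC.
by apply: wA; rewrite !inE ya.
Qed.

Lemma subset_of_card (C : {set V}) k : (k <= #|C|)%N -> exists2 S : {set V}, S \subset C & #|S| = k.
Proof.
move=> kC; exists [set x in take k (enum C)].
  by apply/subsetP => x; rewrite inE => /mem_take; rewrite mem_enum.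
rewrite cardsE; have /card_uniqP-> : uniq (take k (enum C)) by rewrite take_uniq ?enum_uniq.
by rewrite size_takel // -cardE.
Qed.

(** A component with at most [s0] vertices would have a neighbour in [N] outside itself by
    [one_hit]. So the components of [u] and [v] are larger, and [two_hits] gives subsets of size
    [s0] of them a common neighbour in [N]. *)
Lemma hits_connection d M s0 E : is_graph E -> (0 < s0)%N ->
  one_hit d M s0 E -> two_hits d M s0 E -> connection_property (adj E) d M.
Proof.
move=> Eg s00 h1 h2 A B Ad BM AB u v uN vN.
set N := nbhd (adj E) A B; set r := (fun x y => _).
have NA x : x \in N -> x \notin A.
  by case/nbhdP => _ h _; apply/negP => /h; rewrite adj_irr.
have NB x : x \in N -> x \notin B by case/nbhdP.
have disN (X C : {set V}) : (forall x, x \in N -> x \notin X) -> C \subset N -> [disjoint X & C].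
  move=> NX CN; rewrite disjoint_sym disjoint_subset; apply/subsetP => x /(subsetP CN)/NX.
  by rewrite inE.
have grow (C : {set V}) x : C \subset N -> x \in C ->
    (forall y w, y \in C -> w \in N -> adj E y w -> w \in C) -> (s0 < #|C|)%N.
  move=> CN xC Cext; rewrite ltnNge; apply/negP => Cs.
  have C0 : (0 < #|C|)%N by apply/card_gt0P; exists x.
  have [||||||w [wN wC [y yC wy]]] := one_hitP (A := A) (B := B) (S := C) h1 => //.
  - by rewrite C0.
  - exact: disN.
  - exact: disN.
  by case/negP: wC; apply: (Cext y) => //; rewrite adjC.
pose C := [set x in N | connect r u x]; pose C' := [set x in N | connect r x v].
have CN : C \subset N by apply/subsetP => x; rewrite inE => /andP[].
have C'N : C' \subset N by apply/subsetP => x; rewrite inE => /andP[].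
have sC : (s0 < #|C|)%N.
  apply: (grow C u) => //; first by apply/setIdP; rewrite connect0.
  move=> y w /setIdP[yN uy] wN yw; apply/setIdP; split=> //.
  by apply: connect_trans uy (connect1 _); rewrite /r yw.
have sC' : (s0 < #|C'|)%N.
  apply: (grow C' v) => //; first by apply/setIdP; rewrite connect0.
  move=> y w /setIdP[yN yv] wN yw; apply/setIdP; split=> //.
  by apply: connect_trans (connect1 _) yv; rewrite /r adjC yw.
have [CC'|] := boolP [disjoint C & C']; last first.
  rewrite -setI_eq0 => /set0Pn[x /setIP[/setIdP[_ ux] /setIdP[_ xv]]].
  exact: connect_trans ux xv.
have [S SC Ss] := subset_of_card (ltnW sC); have [S' SC' Ss'] := subset_of_card (ltnW sC').
move/forallP: h2 => /(_ (A, B, (S, S')))/= /implyP h2.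
have SSN : S :|: S' \subset N by rewrite subUset (subset_trans SC) // (subset_trans SC').
have /existsP[w /andP[wn hw]] :
    [exists w, (w \notin A :|: B :|: (S :|: S')) && hits E A B [:: S; S'] w].
  apply: h2; rewrite Ad BM Ss Ss' !eqxx AB (disN A) // (disN B) //=.
  by rewrite (disjointWl SC) ?(disjointWr SC' CC').
have wN : w \in N by apply: hits_nbhd hw _; move: wn; rewrite !inE !negb_or => /andP[/andP[]].
case/and3P: hw => _ _ /= /and3P[/existsP[x /andP[xS wx]] /existsP[x' /andP[xS' wx']] _].
have /setIdP[_ ux] := subsetP SC x xS.
have /setIdP[x'N x'v] := subsetP SC' x' xS'.
have xw : r x w by rewrite /r adjC wx.
have wr : r w x' by rewrite /r wx' x'N.
exact: connect_trans (connect_trans ux (connect1 xw)) (connect_trans (connect1 wr) x'v).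
Qed.
End GraphExtension.

(** * Probability that a hitting property fails *)

Section FailureBound.
Variables (R : realFieldType) (n : nat) (p : R).
Notation V := 'I_n.
Hypotheses (p0 : 0 <= p) (p1 : p <= 1).
Implicit Types (E : {set {set V}}) (A B S X : {set V}).

Definition all_edges : seq {set V} := enum [set e : {set V} | #|e| == 2%N].
Notation Ex := (expect p all_edges).

Definition star w (X : {set V}) : {set {set V}} := [set [set w; x] | x in X].

Lemma star_disjoint w X w' X' : w \notin X' -> w' \notin X ->
  w != w' \/ [disjoint X & X'] -> [disjoint star w X & star w' X'].
Proof.
move=> wX' w'X h; rewrite -setI_eq0 -subset0; apply/subsetP => e /setIP[/imsetP[x xX ->]].
case/imsetP=> x' x'X' E.
have : w \in [set w'; x'] by rewrite -E !inE eqxx.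
rewrite !inE => /orP[/eqP ww'|/eqP wx']; last by rewrite wx' x'X' in wX'.
have : x \in [set w'; x'] by rewrite -E !inE eqxx orbT.
rewrite !inE => /orP[/eqP xw'|/eqP xx']; first by rewrite -xw' xX in w'X.
case: h => [|/disjointFr/(_ xX)]; first by rewrite ww' eqxx.
by rewrite xx' x'X'.
Qed.

Lemma starU w X Y : star w X :|: star w Y = star w (X :|: Y).
Proof. by rewrite /star imsetU. Qed.

Lemma adj_star w x X e E : x \in X -> e \notin star w X ->
  adj (e |: E) w x = adj E w x.
Proof.
move=> xX eX; rewrite /adj inE in_set1; case: eqVneq => // we.
by case/negP: eX; rewrite -we /star (imset_f (fun y => [set w; y])).
Qed.

Lemma depends_adj w x (F : bool -> R) :
  depends (star w [set x]) (fun E => F (adj E w x)).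
Proof. by move=> e E eX; rewrite (adj_star _ _ eX) ?set11. Qed.

Lemma depends_all_adj w A :
  depends (star w A) (fun E => [forall a in A, adj E w a]%:R : R).
Proof.
move=> e E eA; rewrite (eq_forallb_in (fun a aA => adj_star E aA eA)) //.
Qed.

Lemma depends_none_adj w B :
  depends (star w B) (fun E => [forall b in B, ~~ adj E w b]%:R : R).
Proof.
move=> e E eB; congr (nat_of_bool _)%:R; apply: eq_forallb_in => b bB.
by rewrite (adj_star E bB eB).
Qed.

Lemma depends_some_adj w S :
  depends (star w S) (fun E => [exists x in S, adj E w x]%:R : R).
Proof.
move=> e E eS; congr (nat_of_bool _)%:R; apply: eq_existsb_in => x xS.
by rewrite (adj_star E xS eS).
Qed.

Lemma expect_adj w x : w != x -> Ex (fun E => (adj E w x)%:R) = p.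
Proof.
by move=> wx; apply: expect_mem; rewrite ?enum_uniq // mem_enum inE cards2 wx.
Qed.

Lemma expect_all_adj w A : w \notin A ->
  Ex (fun E => [forall a in A, adj E w a]%:R) = p ^+ #|A|.
Proof.
move=> wA; rewrite (@eq_expect _ _ _ _ _ (fun E => \prod_(a in A) (adj E w a)%:R)); last first.
  move=> E; case: (boolP [forall a in A, _]) => [/forall_inP h|/forall_inPn[a aA na]].
    by rewrite big1 // => a /h->.
  by rewrite (bigD1 a) //= (negbTE na) mul0r.
rewrite (@expect_prod _ _ _ _ _ _ (fun a => star w [set a])).
- rewrite -prodr_const; apply: eq_bigr => a aA; apply: expect_adj.
  by apply: contraNneq wA => ->.
- by move=> a _; apply: (@depends_adj w a (fun b : bool => b%:R)).
- move=> a b aA bA ab; apply: star_disjoint; rewrite ?in_set1.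
  + by apply: contraNneq wA => ->.
  + by apply: contraNneq wA => ->.
  + by right; rewrite disjoints1 inE.
Qed.

Lemma expect_none_adj w B : w \notin B ->
  Ex (fun E => [forall b in B, ~~ adj E w b]%:R) = (1 - p) ^+ #|B|.
Proof.
move=> wB; rewrite (@eq_expect _ _ _ _ _ (fun E => \prod_(b in B) (1 - (adj E w b)%:R))); last first.
  move=> E; case: (boolP [forall b in B, _]) => [/forall_inP h|/forall_inPn[b bB nb]].
    by rewrite big1 // => b /h/negbTE->; rewrite subr0.
  by rewrite (bigD1 b) //= -[adj _ _ _]negbK (negbTE nb) subrr mul0r.
rewrite (@expect_prod _ _ _ _ _ _ (fun b => star w [set b])).
- rewrite -prodr_const; apply: eq_bigr => b bB.
  rewrite expectB expectC expect_adj //; by apply: contraNneq wB => ->.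
- by move=> b _; apply: (@depends_adj w b (fun c : bool => 1 - c%:R)).
- move=> a b aA bA ab; apply: star_disjoint; rewrite ?in_set1.
  + by apply: contraNneq wB => ->.
  + by apply: contraNneq wB => ->.
  + by right; rewrite disjoints1 inE.
Qed.

Lemma expect_some_adj w S : w \notin S ->
  Ex (fun E => [exists x in S, adj E w x]%:R) = 1 - (1 - p) ^+ #|S|.
Proof.
move=> wS; rewrite -(expect_none_adj wS) -[X in X - _](expectC p all_edges) -expectB.
apply: eq_expect => E; rewrite -negb_exists_in.
by case: [exists _ in _, _]; rewrite ?subr0 ?subrr.
Qed.

Lemma expect_hits w A B S : w \notin A :|: B :|: S -> [disjoint A & B] ->
  [disjoint A & S] -> [disjoint B & S] ->
  Ex (fun E => (hits E A B [:: S] w)%:R) =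
  p ^+ #|A| * (1 - p) ^+ #|B| * (1 - (1 - p) ^+ #|S|).
Proof.
rewrite !inE !negb_or => /andP[/andP[wA wB] wS] AB AS BS.
rewrite -(expect_all_adj wA) -(expect_none_adj wB) -(expect_some_adj wS).
rewrite -(expectM _ _ (@depends_all_adj w A) (@depends_none_adj w B)); last first.
  by apply: star_disjoint => //; right.
rewrite -(expectM _ _ (dependsM (@depends_all_adj w A) (@depends_none_adj w B))
  (@depends_some_adj w S)).
  by apply: eq_expect => E; rewrite /hits /= andbT -!mulnb !natrM mulrA.
rewrite starU; apply: star_disjoint; rewrite ?inE ?negb_or ?wA ?wB //; right.
by rewrite -setI_eq0 setIUl setU_eq0 !setI_eq0 AS.
Qed.

Lemma expect_hits2 w A B S S' : w \notin A :|: B :|: (S :|: S') -> [disjoint A & B] ->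
  [disjoint A & S :|: S'] -> [disjoint B & S :|: S'] -> [disjoint S & S'] ->
  Ex (fun E => (hits E A B [:: S; S'] w)%:R) =
  p ^+ #|A| * (1 - p) ^+ #|B| * ((1 - (1 - p) ^+ #|S|) * (1 - (1 - p) ^+ #|S'|)).
Proof.
rewrite !inE !negb_or => /andP[/andP[wA wB] /andP[wS wS']] AB.
rewrite ![[disjoint _ & S :|: S']]disjoint_sym -![[disjoint S :|: S' & _]]setI_eq0.
rewrite !setIUl !setU_eq0 !setI_eq0 => /andP[AS AS'] /andP[BS BS'] SS'.
rewrite -(expect_all_adj wA) -(expect_none_adj wB) -(expect_some_adj wS) -(expect_some_adj wS').
rewrite -(expectM _ _ (@depends_all_adj w A) (@depends_none_adj w B)); last first.
  by apply: star_disjoint => //; right.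
rewrite -(expectM _ _ (@depends_some_adj w S) (@depends_some_adj w S')); last first.
  by apply: star_disjoint => //; right.
rewrite -(expectM _ _ (dependsM (@depends_all_adj w A) (@depends_none_adj w B))
  (dependsM (@depends_some_adj w S) (@depends_some_adj w S'))).
  by apply: eq_expect => E; rewrite /hits /= andbT -!mulnb !natrM !mulrA.
rewrite !starU; apply: star_disjoint; rewrite ?inE ?negb_or ?wA ?wB ?wS ?wS' //; right.
rewrite -setI_eq0 setIUl setU_eq0 !setI_eq0.
by rewrite ![[disjoint _ & S :|: S']]disjoint_sym -!setI_eq0 !setIUl !setU_eq0 !setI_eq0 AS AS' BS BS'.
Qed.

Lemma depends_hits w A B Ss (X : {set V}) :
  A \subset X -> B \subset X -> all (fun S : {set V} => S \subset X) Ss ->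
  depends (star w X) (fun E => (hits E A B Ss w)%:R : R).
Proof.
move=> /subsetP AX /subsetP BX /allP SX e E eX; congr (nat_of_bool _)%:R.
congr [&& _, _ & _].
- by apply: eq_forallb_in => a aA; rewrite (adj_star E (AX a aA) eX).
- by apply: eq_forallb_in => b bB; rewrite (adj_star E (BX b bB) eX).
- apply: eq_in_all => S SS; apply: eq_existsb_in => x xS.
  by rewrite (adj_star E (subsetP (SX S SS) x xS) eX).
Qed.

(** The stars from distinct vertices outside [X] to [X] share no edge, so the failures at these
    [n - #|X|] vertices are independent. *)
Lemma expect_no_hit A B Ss (X : {set V}) q :
  A \subset X -> B \subset X -> all (fun S : {set V} => S \subset X) Ss ->
  (forall w, w \notin X -> Ex (fun E => (hits E A B Ss w)%:R) = q) ->
  Ex (fun E => (~~ [exists w, (w \notin X) && hits E A B Ss w])%:R) = (1 - q) ^+ (n - #|X|).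
Proof.
move=> AX BX SX hq.
rewrite (@eq_expect _ _ _ _ _ (fun E => \prod_(w in ~: X) (1 - (hits E A B Ss w)%:R))).
  rewrite (@expect_prod _ _ _ _ _ _ (fun w => star w X)).
  - have -> : (n - #|X|)%N = #|~: X| by rewrite [RHS]cardsCs setCK card_ord.
    rewrite -prodr_const; apply: eq_bigr => w; rewrite inE => wX.
    by rewrite expectB expectC hq.
  - by move=> w _; apply/depends1B/depends_hits.
  - by move=> w w'; rewrite !inE => wX w'X ww'; apply: star_disjoint => //; left.
move=> E; case: (boolP [exists w, _]) => [/existsP[w /andP[wX hw]]|/existsPn h].
  by rewrite (bigD1 w) ?inE //= hw subrr mul0r.
rewrite big1 // => w; rewrite inE => wX.
by have := h w; rewrite wX /= => /negbTE->; rewrite subr0.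
Qed.

Lemma union_bound (J : finType) (Q : J -> {set {set V}} -> bool) :
  Ex (fun E => 1 - [forall j, Q j E]%:R) <= \sum_j Ex (fun E => (~~ Q j E)%:R).
Proof.
rewrite -expect_bigsum; apply: le_expect => // E.
case: (boolP [forall j, _]) => [_|/forallPn[j nj]].
  by rewrite subrr sumr_ge0.
by rewrite subr0 (bigD1 j) //= nj lerDl sumr_ge0.
Qed.

(** Every set counted has [t ^+ #|A| >= t ^+ k], and the sum of [t ^+ #|A|] over all sets is a
    binomial expansion. *)
Lemma card_small_sets (t : R) k : 0 < t -> t <= 1 ->
  \sum_(A : {set V} | (#|A| <= k)%N) 1 <= t ^- k * (1 + t) ^+ n.
Proof.
move=> t0 t1; rewrite -[n in leRHS]card_ord -sum_subsets mulr_sumr big_mkcond.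
apply: ler_sum => A _; case: ifP => Ak; last by rewrite mulr_ge0 ?invr_ge0 ?exprn_ge0 ?ltW.
rewrite mulrC ler_pdivlMr ?exprn_gt0 // mul1r.
by apply: ler_wiXn2l; rewrite // ltW.
Qed.

Lemma sum_nonempty_sets (y : R) :
  \sum_(S : {set V} | (0 < #|S|)%N) y ^+ #|S| = (1 + y) ^+ n - 1.
Proof.
rewrite -[n in RHS]card_ord -sum_subsets [in RHS](bigD1 set0) //= cards0 expr0 addrAC subrr add0r.
by apply: eq_bigl => S; rewrite card_gt0.
Qed.

(** The union bound runs over [A], [B] and the sets to be hit. A bound of [y] per vertex of the
    latter beats their number: their sum is [(1 + y) ^+ n - 1] for one set and its square for two.
    The sets [A] and [B] contribute only their number. *)
Lemma failure_bound d M s0 (y t : R) : 0 <= y -> 0 < t -> t <= 1 -> (0 < s0)%N ->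
  (forall a b s, (a <= d)%N -> (b <= M)%N -> (0 < s <= s0)%N ->
    (1 - p ^+ a * (1 - p) ^+ b * (1 - (1 - p) ^+ s)) ^+ (n - (a + b + s)) <= y ^+ s) ->
  (forall a b, (a <= d)%N -> (b <= M)%N ->
    (1 - p ^+ a * (1 - p) ^+ b * (1 - (1 - p) ^+ s0) ^+ 2) ^+ (n - (a + b + (s0 + s0)))
      <= y ^+ (s0 + s0)) ->
  Ex (fun E => 1 - (one_hit d M s0 E && two_hits d M s0 E)%:R) <=
  (t ^- d * (1 + t) ^+ n) * (t ^- M * (1 + t) ^+ n) *
  (((1 + y) ^+ n - 1) + ((1 + y) ^+ n - 1) ^+ 2).
Proof.
move=> y0 t0 t1 s00 H1 H2.
have sy0 : 0 <= (1 + y) ^+ n - 1.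
  by rewrite -sum_nonempty_sets sumr_ge0 // => S _; rewrite exprn_ge0.
apply: le_trans (_ : Ex (fun E => 1 - (one_hit d M s0 E)%:R) +
    Ex (fun E => 1 - (two_hits d M s0 E)%:R) <= _).
  rewrite -expectD; apply: le_expect => // E.
  by case: one_hit; case: two_hits; rewrite /= ?subrr ?subr0 ?addr0 ?add0r ?lerDl.
have cT k : 0 <= \sum_(A : {set V} | (#|A| <= k)%N) (1 : R) by apply: sumr_ge0.
pose cA := \sum_(A : {set V} | (#|A| <= d)%N) (1 : R).
pose cB := \sum_(A : {set V} | (#|A| <= M)%N) (1 : R).
have cAB (z : R) : 0 <= z -> cA * cB * z <= (t ^- d * (1 + t) ^+ n) * (t ^- M * (1 + t) ^+ n) * z.
  move=> z0; apply: ler_wpM2r => //.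
  by apply: ler_pM; rewrite ?cT //; apply: card_small_sets.
rewrite mulrDr; apply: lerD.
- apply: le_trans (cAB _ sy0); apply: le_trans (union_bound _) _.
  rewrite -sum_nonempty_sets.
  apply: le_trans (_ : \sum_(u : {set V} * {set V} * {set V})
     (if (#|u.1.1| <= d)%N then 1 else 0) * (if (#|u.1.2| <= M)%N then 1 else 0) *
     (if (0 < #|u.2|)%N then y ^+ #|u.2| else 0) <= _); last first.
    rewrite -(pair_bigA _ (fun (u : {set V} * {set V}) (S : {set V}) =>
      (if (#|u.1| <= d)%N then 1 else 0) * (if (#|u.2| <= M)%N then 1 else 0) *
      (if (0 < #|S|)%N then y ^+ #|S| else 0))) /=.
    under eq_bigr do rewrite -mulr_sumr -big_mkcond /=.
    rewrite -mulr_suml -(pair_bigA _ (fun (A B : {set V}) =>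
      (if (#|A| <= d)%N then 1 else 0) * (if (#|B| <= M)%N then 1 else 0))) /=.
    under eq_bigr do rewrite -mulr_sumr -big_mkcond /=.
    by rewrite -mulr_suml -big_mkcond.
  apply: ler_sum => -[[A B] S] _ /=.
  have [/and5P[Ad BM S0 Ss /and3P[AB AS BS]]|ncond] := boolP [&& (#|A| <= d)%N, (#|B| <= M)%N,
    (0 < #|S|)%N, (#|S| <= s0)%N, [disjoint A & B], [disjoint A & S] & [disjoint B & S]]; last first.
    by rewrite expectC !mulr_ge0 //; case: ifP => // _; rewrite exprn_ge0.
  rewrite Ad BM S0 !mul1r.
  rewrite (@expect_no_hit A B [:: S] (A :|: B :|: S)
    (p ^+ #|A| * (1 - p) ^+ #|B| * (1 - (1 - p) ^+ #|S|))).
  + have -> : #|A :|: B :|: S| = (#|A| + #|B| + #|S|)%N.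
      rewrite !cardsU (disjoint_setI0 AB) cards0 subn0.
      by rewrite setIUl (disjoint_setI0 AS) (disjoint_setI0 BS) setU0 cards0 subn0.
    by apply: H1; rewrite ?S0.
  + by rewrite -setUA subsetUl.
  + by rewrite setUAC subsetUr.
  + by rewrite /= subsetUr.
  + by move=> w wn; apply: expect_hits.
- apply: le_trans (cAB _ (exprn_ge0 _ sy0)); apply: le_trans (union_bound _) _.
  rewrite -sum_nonempty_sets.
  apply: le_trans (_ : \sum_(u : {set V} * {set V} * ({set V} * {set V}))
     (if (#|u.1.1| <= d)%N then 1 else 0) * (if (#|u.1.2| <= M)%N then 1 else 0) *
     ((if (0 < #|u.2.1|)%N then y ^+ #|u.2.1| else 0) *
      (if (0 < #|u.2.2|)%N then y ^+ #|u.2.2| else 0)) <= _); last first.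
    rewrite -(pair_bigA _ (fun (u v : {set V} * {set V}) =>
      (if (#|u.1| <= d)%N then 1 else 0) * (if (#|u.2| <= M)%N then 1 else 0) *
      ((if (0 < #|v.1|)%N then y ^+ #|v.1| else 0) *
       (if (0 < #|v.2|)%N then y ^+ #|v.2| else 0)))) /=.
    under eq_bigr do rewrite -mulr_sumr.
    rewrite -mulr_suml -(pair_bigA _ (fun (A B : {set V}) =>
      (if (#|A| <= d)%N then 1 else 0) * (if (#|B| <= M)%N then 1 else 0))) /=.
    under eq_bigr do rewrite -mulr_sumr -big_mkcond /=.
    rewrite -mulr_suml -big_mkcond /= -(pair_bigA _ (fun (A B : {set V}) =>
      (if (0 < #|A|)%N then y ^+ #|A| else 0) * (if (0 < #|B|)%N then y ^+ #|B| else 0))) /=.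
    under [X in _ * X <= _]eq_bigr do rewrite -mulr_sumr -big_mkcond /=.
    by rewrite -mulr_suml -big_mkcond.
  apply: ler_sum => -[[A B] [S S']] _ /=.
  have [/and5P[Ad BM /eqP Ss /eqP Ss' /and4P[AB AS BS SS']]|ncond] := boolP [&& (#|A| <= d)%N,
    (#|B| <= M)%N, #|S| == s0, #|S'| == s0, [disjoint A & B], [disjoint A & S :|: S'],
    [disjoint B & S :|: S'] & [disjoint S & S']]; last first.
    by rewrite expectC !mulr_ge0 //; case: ifP => // _; rewrite exprn_ge0.
  rewrite Ad BM !Ss !Ss' s00 !mul1r -exprD.
  rewrite (@expect_no_hit A B [:: S; S'] (A :|: B :|: (S :|: S'))
    (p ^+ #|A| * (1 - p) ^+ #|B| * (1 - (1 - p) ^+ s0) ^+ 2)).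
  + have -> : #|A :|: B :|: (S :|: S')| = (#|A| + #|B| + (s0 + s0))%N.
      rewrite !cardsU (disjoint_setI0 AB) cards0 subn0.
      rewrite (disjoint_setI0 SS') cards0 subn0 Ss Ss'.
      by rewrite setIUl (disjoint_setI0 AS) (disjoint_setI0 BS) setU0 cards0 subn0.
    exact: H2.
  + by rewrite -setUA subsetUl.
  + by rewrite setUAC subsetUr.
  + rewrite /= andbT; apply/andP; split; apply: subset_trans (subsetUr (A :|: B) _).
      exact: subsetUl.
    exact: subsetUr.
  + by move=> w wn; rewrite expect_hits2 // Ss Ss' expr2.
Qed.
End FailureBound.

From mathcomp Require Import all_classical all_reals all_analysis.
Import numFieldNormedType.Exports.
Local Open Scope classical_set_scope.
Local Open Scope ring_scope.

(** * Coincidences from antipodal chains *)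

Section MatrixNorm.
Variables (R : realType) (m n : nat).
Implicit Types (A B : 'M[R]_(m, n)).

Lemma mx_entry_le A i j : `|A i j| <= `|A|.
Proof.
rewrite [leRHS]/Num.Def.normr /= mx_normrE.
exact: (le_bigmax 0 (fun ij : 'I_m * 'I_n => `|A ij.1 ij.2|) (i, j)).
Qed.

Lemma mx_norm_le A e : 0 <= e -> (forall i j, `|A i j| <= e) -> `|A| <= e.
Proof.
move=> e0 h; rewrite [leLHS]/Num.Def.normr /= mx_normrE.
by apply: bigmax_le => // -[i j] _; apply: h.
Qed.

Lemma nbhs_mx_ball A (U : set 'M[R]_(m, n)) :
  nbhs A U <-> exists2 r, 0 < r & forall B, `|A - B| < r -> U B.
Proof.
split=> [/nbhs_ballP[r r0 rU]|[r r0 rU]].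
  by exists r => // B AB; apply: rU; rewrite mx_norm_ball.
by apply/nbhs_ballP; exists r => // B; rewrite mx_norm_ball; apply: rU.
Qed.

End MatrixNorm.

Section MatrixCompactness.
Variables (R : realType) (m n : nat).

Lemma bounded_closed_mx_compact (K : set 'M[R]_(m, n)) M :
  (forall x, K x -> `|x| <= M) -> closed K -> compact K.
Proof.
move=> KM Kcl.
have vc : continuous (vec_mx : 'rV[R]_(m * n) -> 'M[R]_(m, n)).
  move=> v U /nbhs_mx_ball[r r0 rU]; apply/nbhs_ballP.
  exists (r / 2); first by rewrite /= divr_gt0.
  move=> w; rewrite mx_norm_ball /= => vw; apply: rU.
  apply: le_lt_trans (_ : r / 2 < r); last by rewrite ltr_pdivrMr // mulr_natr mulr2n ltrDl.
  apply: mx_norm_le; first by rewrite divr_ge0 // ltW.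
  move=> i j; rewrite !mxE.
  by have := mx_entry_le (v - w) ord0 (mxvec_index i j); rewrite !mxE => /le_trans; apply; apply: ltW.
have -> : K = vec_mx @` (vec_mx @^-1` K).
  apply/seteqP; split=> [x Kx|x [v Kv <-]//].
  by exists (mxvec x); rewrite /= ?mxvecK.
apply: continuous_compact; first exact: continuous_subspaceT.
apply: bounded_closed_compact.
  exists M; split; first exact: num_real.
  move=> B MB v /= /KM vM; apply: ltW; apply: le_lt_trans MB.
  apply: mx_norm_le; first exact: le_trans vM.
  move=> i j; rewrite (ord1 i) {i}.
  case: (mxvec_indexP j) => a b.
  by have := mx_entry_le (vec_mx v) a b; rewrite mxE => /le_trans; apply.
by apply: closed_comp => // v _; apply: vc.
Qed.

(** A Lebesgue number argument. Half of the local radius is spent on the distance from [x] to [y]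
    and half on that from [y] to [z]. *)
Lemma compact_uniform_radius (K : set 'M[R]_(m, n)) (Q : 'M[R]_(m, n) -> 'M[R]_(m, n) -> Prop) :
  compact K ->
  (forall x, K x -> exists2 r, 0 < r & forall y z, K y -> K z ->
    `|x - y| < r -> `|x - z| < r -> Q y z) ->
  exists2 r, 0 < r & forall y z, K y -> K z -> `|y - z| < r -> Q y z.
Proof.
move=> /compact_near_coveringP/near_covering_withinP cov loc.
pose P (r : R) y := forall z, K z -> `|y - z| < r -> Q y z.
have : \forall r \near (0 : R)^'+, K `<=` P r.
  apply: cov => x Kx; have [r r0 hr] := loc x Kx.
  exists ([set y | `|x - y| < r / 2], [set e | e < r / 2]).
    split=> /=; last by apply: nbhs_right_lt; rewrite divr_gt0.
    by apply/nbhs_mx_ball; exists (r / 2) => //; rewrite divr_gt0.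
  move=> [y e] /= [xy er] Ky z Kz yz; apply: hr => //.
    by apply: lt_trans xy _; lra.
  rewrite -(subrKA y); apply: le_lt_trans (ler_normD _ _) _; lra.
move=> cov0; near (0 : R)^'+ => r.
exists r => // y z Ky Kz; have : K `<=` P r by near: r.
by move=> /(_ y Ky); apply.
Unshelve. all: by end_near. Qed.

End MatrixCompactness.

(** * The geometric realization is compact and invariant *)

Section Realization.
Variables (R : realType) (n : nat) (E : {set {set 'I_n}}).
Notation K := (sdj_realization (R := R) E).

Lemma sdj_face_sub (s t s' t' : {set 'I_n}) : s' \subset s -> t' \subset t ->
  sdj_face E s t -> sdj_face E s' t'.
Proof.
move=> ss tt /and4P[cs ct dst /forall_inP nadj].
have clsub (a b : {set 'I_n}) : a \subset b -> is_clique E b -> is_clique E a.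
  move=> /fintype.subsetP ab /forall_inP h; apply/forall_inP => u /ab ub.
  by apply/forall_inP => v /ab vb; have /forall_inP := h u ub; apply.
apply/and4P; split; [exact: clsub ss cs|exact: clsub tt ct| |].
  exact: disjointWl ss (disjointWr tt dst).
apply/forall_inP => u /(fintype.subsetP ss) us; apply/forall_inP => v /(fintype.subsetP tt) vt.
by have /forall_inP := nadj u us; apply.
Qed.

(** Coordinates may vanish in the limit but none can appear. So the support of [x] is contained in
    that of a nearby point of [K], and subsets of faces are faces. *)
Lemma sdj_realization_closed : closed K.
Proof.
move=> x xcl.
have near_pt e : 0 < e -> exists2 y, K y & `|x - y| < e.
  move=> e0; have [|y [Ky xy]] := xcl [set y | `|x - y| < e]; last by exists y.
  by apply/nbhs_mx_ball; exists e.
have x0 i j : 0 <= x i j.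
  rewrite leNgt; apply/negP => xij.
  have [|y [y0 _]] := near_pt (- x i j); first by rewrite oppr_gt0.
  have := mx_entry_le (x - y) i j; rewrite !mxE => /le_lt_trans h /h.
  by rewrite distrC ltr_norml => /andP[_]; have := y0 i j; lra.
split=> //; split.
  apply/eqP; rewrite -subr_eq0; apply: contraT => nz.
  set S := \sum_i _ in nz.
  have [|y [_ [y1 _]] xy] := near_pt (`|S - 1| / (2 * n%:R + 1)).
    by rewrite divr_gt0 ?normr_gt0.
  have : `|S - 1| <= (2 * n%:R) * `|x - y|.
    rewrite -[X in `|S - X|]y1 /S -sumrB; under eq_bigr do rewrite -sumrB.
    apply: le_trans (ler_norm_sum _ _ _) _.
    apply: le_trans (_ : \sum_(i < 2) (n%:R * `|x - y|) <= _); last first.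
      by rewrite sumr_const card_ord -[leLHS]mulr_natl mulrA.
    apply: ler_sum => i _.
    apply: le_trans (ler_norm_sum _ _ _) _.
    apply: le_trans (_ : \sum_(j < n) `|x - y| <= _); last first.
      by rewrite sumr_const card_ord -[leLHS]mulr_natl.
    apply: ler_sum => j _.
    by have := mx_entry_le (x - y) i j; rewrite !mxE.
  move=> h; move: xy; rewrite ltr_pdivlMr // mulrDr mulr1 mulrC => xy.
  have := normr_ge0 (x - y); lra.
(* At most the least nonzero coordinate of [x]: a point closer than [e] to [x] has no zero in the
   support of [x]. *)
pose e := \big[Num.min/1]_(ij : 'I_2 * 'I_n | x ij.1 ij.2 != 0) x ij.1 ij.2.
have e0 : 0 < e.
  rewrite /e; elim/big_ind: _ => // [a b a0 b0|ij nz]; first by rewrite lt_min a0.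
  by rewrite lt_neqAle eq_sym nz x0.
have [y [y0 [_ yf]] xy] := near_pt e e0.
have sup i j : x i j != 0 -> y i j != 0.
  move=> nz; have : e <= x i j by apply: (bigmin_le_cond _ (j := (i, j))).
  have := le_lt_trans (mx_entry_le (x - y) i j) xy; rewrite !mxE ltr_norml => /andP[_ h] h'.
  by apply: contraTneq h => ->; rewrite subr0 -leNgt.
by apply: sdj_face_sub yf; apply/fintype.subsetP => j; rewrite !inE; apply: sup.
Qed.

Lemma sdj_realization_compact : compact K.
Proof.
apply: (@bounded_closed_mx_compact _ _ _ _ 1) sdj_realization_closed => x [x0 [x1 _]].
apply: mx_norm_le => // i j; rewrite ger0_norm // -x1 (bigD1 i) //= (bigD1 j) //= -addrA.
by rewrite lerDl addr_ge0 ?sumr_ge0 // => k _; rewrite sumr_ge0.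
Qed.

Lemma sdj_invK : involutive (@sdj_inv R n).
Proof. by move=> x; apply/matrixP => i j; rewrite !mxE rev_ordK. Qed.

Lemma sdj_inv_norm (x y : 'M[R]_(2, n)) : `|sdj_inv x - sdj_inv y| <= `|x - y|.
Proof.
apply: mx_norm_le => // i j; rewrite !mxE.
by have := mx_entry_le (x - y) (rev_ord i) j; rewrite !mxE.
Qed.

Lemma rev_ord2 : rev_ord (ord0 : 'I_2) = ord_max /\ rev_ord (ord_max : 'I_2) = ord0.
Proof. by split; apply/val_inj. Qed.

Lemma sdj_inv_realization x : K x -> K (sdj_inv x).
Proof.
move=> [x0 [x1 xf]]; split=> [i j|]; first by rewrite mxE.
split.
  rewrite -[RHS]x1 (reindex_inj rev_ord_inj); apply: eq_bigr => i _.
  by apply: eq_bigr => j _; rewrite mxE rev_ordK.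
have [r0 r1] := rev_ord2.
have -> : mx_supp (sdj_inv x) ord0 = mx_supp x ord_max.
  by apply/setP => j; rewrite !inE mxE r0.
have -> : mx_supp (sdj_inv x) ord_max = mx_supp x ord0.
  by apply/setP => j; rewrite !inE mxE r1.
case/and4P: xf => cs ct dst /forall_inP nadj; apply/and4P; split=> //.
  by rewrite disjoint_sym.
apply/forall_inP => u us; apply/forall_inP => v vt.
by have /forall_inP := nadj v vt => /(_ u us); rewrite /adj finset.setUC.
Qed.

End Realization.

Section Coincidence.
Variables (R : realType) (n : nat) (E : {set {set 'I_n}}) (d : nat).
Notation K := (sdj_realization (R := R) E).

Lemma within_continuous_dist (f : 'M[R]_(2, n) -> 'rV[R]_d.+1) x e :
  {within K, continuous f} -> K x -> 0 < e ->
  exists2 r, 0 < r & forall y, K y -> `|x - y| < r -> `|f x - f y| < e.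
Proof.
move=> /subspace_continuousP fc Kx e0.
have /cvgrPdist_lt /(_ e e0) := fc x Kx.
rewrite near_withinE => /nbhs_mx_ball[r r0 h]; exists r => // y Ky xy.
exact: h xy Ky.
Qed.

Definition vertex_pt (x : bool * 'I_n) : 'M[R]_(2, n) :=
  delta_mx (if x.1 then ord_max else ord0) x.2.

Lemma vertex_pt_flip x : vertex_pt (flip x) = sdj_inv (vertex_pt x).
Proof.
apply/matrixP => i j; rewrite !mxE; congr (_ && _)%:R.
by case: x => [[] k] /=; case: i => [[|[|]]].
Qed.

Lemma sdj_inv_bary (u : seq 'M[R]_(2, n)) : bary (map (@sdj_inv R n) u) = sdj_inv (bary u).
Proof.
apply/matrixP => i j; rewrite /bary size_map !mxE !summxE big_map.
by congr (_ * _); apply: eq_bigr => x _; rewrite mxE.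
Qed.

Lemma hull_realization (s : {set bool * 'I_n}) y :
  clique (sep_rel (adj E)) finset.setT s -> hull (map vertex_pt (enum s)) y -> K y.
Proof.
move=> /cliqueP[_ cls].
(* Being a face is not stable under averaging, but having support inside the fixed clique [s] is. *)
pose Q (y : 'M[R]_(2, n)) := [/\ forall i j, 0 <= y i j,
  \sum_(i < 2) \sum_(j < n) y i j = 1
  & forall i j, y i j != 0 -> (i == ord_max, j) \in s].
move=> /(_ Q)[].
- move=> x /mapP[[b k]]; rewrite mem_enum => bs ->; split.
  + by move=> i j; rewrite mxE ler0n.
  + rewrite (bigD1 (if b then ord_max else ord0)) //= [X in _ + X]big1 ?addr0.
      rewrite (bigD1 k) //= big1 ?addr0 => [|j jk]; rewrite mxE !eqxx //=.
      by rewrite (negbTE jk).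
    by move=> i ib; rewrite big1 // => j _; rewrite mxE (negbTE ib).
  + move=> i j; rewrite mxE /=; case: andP => [[/eqP-> /eqP->] _|]; last by rewrite eqxx.
    by case: b bs.
- move=> u u0 hu.
  have su : (size u)%:R != 0 :> R by rewrite pnatr_eq0 size_eq0.
  split.
  + move=> i j; rewrite mxE summxE mulr_ge0 ?invr_ge0 //.
    by rewrite big_seq sumr_ge0 // => x /hu[].
  + under eq_bigr => i _ do under eq_bigr => j _ do rewrite mxE summxE.
    under eq_bigr do rewrite -mulr_sumr exchange_big /=.
    rewrite -mulr_sumr exchange_big /= big_seq (eq_bigr (fun=> 1)); last by move=> x /hu[].
    rewrite -big_seq big_const_seq count_predT iter_addr addr0.
    by rewrite -[1 *+ _]/((size u)%:R) mulVf.
  + move=> i j nz; have [/hasP[x xu xn]|] := boolP (has (fun x : 'M[R]_(2, n) => x i j != 0) u).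
      by have [_ _] := hu x xu; apply.
    move=> /hasPn h; case/eqP: nz; rewrite mxE summxE big_seq big1 ?mulr0 // => x /h.
    by rewrite negbK => /eqP.
move=> y0 y1 ys; split=> //; split=> //.
have s0 j : j \in mx_supp y ord0 -> (false, j) \in s by rewrite inE => /ys.
have s1 j : j \in mx_supp y ord_max -> (true, j) \in s by rewrite inE => /ys.
apply/and4P; split.
- apply/forall_inP => u /s0 us; apply/forall_inP => v /s0 vs; apply/implyP => uv.
  have := cls _ _ us vs; rewrite xpair_eqE /= uv => /(_ isT).
  by rewrite /sep_rel.
- apply/forall_inP => u /s1 us; apply/forall_inP => v /s1 vs; apply/implyP => uv.
  have := cls _ _ us vs; rewrite xpair_eqE /= uv => /(_ isT).
  by rewrite /sep_rel.
- rewrite disjoint_subset; apply/fintype.subsetP => u /s0 us; apply/negP => /s1 us'.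
  by have := cls _ _ us us' isT; rewrite /sep_rel /= eqxx.
- apply/forall_inP => u /s0 us; apply/forall_inP => v /s1 vs.
  by have := cls _ _ us vs isT; rewrite /sep_rel /= => /andP[].
Qed.

Theorem coincidence_of_antipodal_chains c :
  antipodal_chains (adj E) d.+1 c -> has_Z2_coincidence R E d.
Proof.
move=> hc f fc; apply: contrapT => no.
pose h x := f x - f (sdj_inv x).
have h0 x : K x -> h x != 0.
  by move=> Kx; apply/negP; rewrite subr_eq0 => /eqP fx; apply: no; exists x.
have hinv x : h (sdj_inv x) = - h x by rewrite /h sdj_invK opprB.
pose top x := [arg max_(i > ord0) `|h x ord0 i|]%O.
have topP x i : `|h x ord0 i| <= `|h x ord0 (top x)|.
  by rewrite /top; case: arg_maxP => // j _ hj; exact: (hj i).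
have top_norm x : `|h x ord0 (top x)| = `|h x|.
  apply/eqP; rewrite eq_le mx_entry_le /=.
  by apply: mx_norm_le => // i j; rewrite (ord1 i).
have top_inv x : top (sdj_inv x) = top x.
  rewrite /top; congr Order.arg_max; apply/funext => i.
  by rewrite hinv mxE normrN.
pose label x := ((top x).*2 + (0 < h x ord0 (top x))%R)%N.
have top_neq0 x : K x -> h x ord0 (top x) != 0.
  by move=> Kx; rewrite -normr_gt0 top_norm normr_gt0 h0.
have opp_labelE (i : nat) (b : bool) : opp_label (i.*2 + b)%N = (i.*2 + ~~ b)%N.
  by rewrite /opp_label oddD odd_double; case: b; rewrite /= ?addn1 ?addn0.
(* With opposite labels, the same coordinate dominates in [h x] and [h y] with opposite signs. In
   the max norm this coordinate alone separates them by the sum of their norms. *)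
have label_near x y : K x -> K y -> label y = opp_label (label x) ->
    `|h x| + `|h y| <= `|h x - h y|.
  move=> Kx Ky; rewrite /label opp_labelE => lE.
  have tE : top y = top x.
    apply/val_inj; have := congr1 half lE.
    by rewrite !(addnC _.*2) !half_bit_double.
  have sE : (0 < h y ord0 (top y)) = ~~ (0 < h x ord0 (top x)).
    by have := congr1 odd lE; rewrite !oddD !odd_double; case: (_ < _); case: (_ < _).
  apply: le_trans (mx_entry_le _ ord0 (top x)).
  rewrite -[in leLHS](top_norm x) -[in leLHS](top_norm y) tE; rewrite tE in sE.
  have -> : (h x - h y) ord0 (top x) = h x ord0 (top x) - h y ord0 (top x).
    by rewrite mxE [X in _ + X]mxE.
  move: sE; set a := h x _ _; set b := h y _ _ => sE.
  case: (ltP 0 a) sE => [a_gt|a_le] /= sE.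
    have b_le : b <= 0 by rewrite leNgt sE.
    rewrite (gtr0_norm a_gt) (ler0_norm b_le).
    exact: ler_norm.
  rewrite (ler0_norm a_le) (gtr0_norm sE) distrC.
  apply: le_trans (ler_norm _); lra.
have [delta delta0 hdelta] : exists2 r, 0 < r & forall x y, K x -> K y ->
    `|x - y| < r -> label y != opp_label (label x).
  apply: (compact_uniform_radius (@sdj_realization_compact R n E)) => x Kx.
  (* Near [x], both [h y] and [h z] are within [2 * e] of [h x], which has norm [6 * e]. Their norms
     exceed [4 * e] each while their distance stays below [4 * e], contrary to [label_near]. *)
  pose e := `|h x| / 6.
  have e0 : 0 < e by rewrite divr_gt0 // normr_gt0 h0.
  have [r1 r10 hr1] := within_continuous_dist fc Kx e0.
  have [r2 r20 hr2] := within_continuous_dist fc (sdj_inv_realization Kx) e0.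
  have hdist y : K y -> `|x - y| < r1 -> `|x - y| < r2 -> `|h x - h y| < 2 * e.
    move=> Ky xy1 xy2.
    have -> : h x - h y = (f x - f y) - (f (sdj_inv x) - f (sdj_inv y)).
      by rewrite /h !opprB addrACA [RHS]addrACA; congr (_ + _); exact: addrC.
    apply: le_lt_trans (ler_normB _ _) _.
    have := hr1 y Ky xy1.
    have := hr2 _ (sdj_inv_realization Ky) (le_lt_trans (sdj_inv_norm _ _) xy2).
    lra.
  exists (Num.min r1 r2); first by rewrite lt_min r10.
  move=> y z Ky Kz; rewrite !lt_min => /andP[xy1 xy2] /andP[xz1 xz2].
  apply/negP => /eqP /(label_near y z Ky Kz).
  have dy := hdist y Ky xy1 xy2; have dz := hdist z Kz xz1 xz2.
  have hy : `|h x| - `|h y| <= `|h x - h y| := lerB_dist _ _.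
  have hz : `|h x| - `|h z| <= `|h x - h z| := lerB_dist _ _.
  have : `|h y - h z| <= `|h x - h y| + `|h x - h z|.
    by rewrite [`|h x - h y|]distrC; apply: ler_distD.
  rewrite /e in dy dz e0; lra.
apply: (@no_antipodal_chains R _ _ (adj E) vertex_pt (@sdj_inv R n) K label d.+1 c delta) => //.
- exact: sdj_inv_bary.
- exact: vertex_pt_flip.
- by move=> s y; apply: hull_realization.
- move=> x Kx; rewrite /label top_inv hinv mxE opp_labelE; congr (_ + _)%N.
  by rewrite oppr_gt0 ltNge le_eqVlt negb_or -eq_sym top_neq0.
- move=> x _; rewrite /label.
  by have := ltn_ord (top x); case: (_ < _)%R; rewrite /= ?addn1 ?addn0; lia.
Qed.

End Coincidence.

(** * Asymptotics *)

Section Gnp.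
Variables (R : realType) (n : nat) (p : R).
Hypotheses (p0 : 0 <= p) (p1 : p <= 1).

Lemma gnp_prob_expect (Q : pred {set {set 'I_n}}) :
  gnp_prob p (fun E => Q E) = expect p (all_edges n) (fun E => (Q E)%:R).
Proof.
rewrite expect_sum ?enum_uniq //; apply: eq_big => E.
  suff -> : ([set x in all_edges n] = [set e : {set 'I_n} | #|e| == 2%N])%SET by [].
  by apply/setP => e; rewrite !inE mem_enum inE.
move=> _; rewrite asboolb; congr (_ * _).
by rewrite /gnp_weight big_enum; apply: eq_bigl => e; rewrite inE.
Qed.

Lemma gnp_weight_ge0 E : 0 <= gnp_weight (n := n) p E.
Proof. by apply: prodr_ge0 => e _; case: ifP => _; rewrite ?subr_ge0. Qed.

Lemma le_gnp_prob (Q Q' : {set {set 'I_n}} -> Prop) :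
  (forall E, is_graph E -> Q E -> Q' E) -> gnp_prob p Q <= gnp_prob p Q'.
Proof.
move=> QQ'; apply: ler_sum => E Eg; apply: ler_wpM2r; first exact: gnp_weight_ge0.
rewrite ler_nat; case: (asboolP (Q E)) => // /(QQ' E Eg) q.
by rewrite asboolT.
Qed.

Lemma gnp_prob_le1 (Q : {set {set 'I_n}} -> Prop) : gnp_prob p Q <= 1.
Proof.
apply: le_trans (@le_gnp_prob _ (fun E => predT E) _) _ => //.
by rewrite gnp_prob_expect expectC.
Qed.
End Gnp.

(** * Exponential bounds for the failure probabilities *)

Section Estimates.
Variable R : realType.

Lemma onem_expr_le (x : R) k : 0 <= x <= 1 -> (1 - x) ^+ k <= expR (- x * k%:R).
Proof.
move=> /andP[x0 x1]; rewrite expRM_natr; apply: lerXn2r.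
- by rewrite nnegrE subr_ge0.
- by rewrite nnegrE expR_ge0.
- exact: expR_ge1Dx.
Qed.

(** This is [1 + u <= expR u] at [u = x / (m + 1)], raised to the power [m + 1]. It lets the
    exponential beat any prescribed power. *)
Lemma expRN_le (x : R) m : 0 < x -> expR (- x) <= (m.+1%:R / x) ^+ m.+1.
Proof.
move=> x0; have m0 : 0 < m.+1%:R :> R by [].
have -> : - x = (- (x / m.+1%:R)) * m.+1%:R by rewrite mulNr divfK ?gt_eqF.
rewrite expRM_natr; apply: lerXn2r.
- by rewrite nnegrE expR_ge0.
- by rewrite nnegrE divr_ge0 // ltW.
rewrite expRN -[leRHS]invrK lef_pV2 ?posrE ?expR_gt0 ?invr_gt0 ?divr_gt0 //.
rewrite invf_div; apply: le_trans (expR_ge1Dx _); by rewrite lerDr.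
Qed.

Lemma some_neighbor_ge (p : R) s : 0 < p -> p <= 1 ->
  (s%:R * p) / (1 + s%:R * p) <= 1 - (1 - p) ^+ s.
Proof.
move=> p0 p1; have sp : 0 <= s%:R * p by rewrite mulr_ge0 // ltW.
have pos : 0 < 1 + s%:R * p by rewrite ltr_wpDr.
rewrite ler_pdivrMr // mulrBl mul1r.
have := @expr_onem_le R p s (ltW p0) p1; lra.
Qed.

Section Rate.
Variables (n d M s0 : nat) (p : R).
Hypotheses (p0 : 0 < p) (p2 : p <= 2^-1) (s0p : 1 <= s0%:R * p) (s0p2 : s0%:R * p <= 2)
  (nbig : ((d + M + (s0 + s0)).*2 <= n)%N).
Let q := p ^+ d * 2^-1 ^+ M.
(** The constant comes from [two_hits]. Each of at least [n / 2] vertices succeeds with probability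
    at least [q / 4], which gives the exponent [q * n / 8]. It has to pay for [2 * s0] factors [y],
    and [s0 * p <= 2]. *)
Let y := expR (- (q * p * n%:R / 32)).

Let p1 : p <= 1. Proof. by apply: le_trans p2 _; lra. Qed.

Let q0 : 0 < q. Proof. by rewrite mulr_gt0 ?exprn_gt0 ?invr_gt0. Qed.

Let q_le a b : (a <= d)%N -> (b <= M)%N -> q <= p ^+ a * (1 - p) ^+ b.
Proof.
move=> ad bM; apply: ler_pM; rewrite ?exprn_ge0 ?invr_ge0 ?(ltW p0) //.
  by apply: ler_wiXn2l; rewrite // ltW.
apply: le_trans (_ : 2^-1 ^+ b <= _).
  by apply: ler_wiXn2l => //; lra.
apply: lerXn2r; rewrite ?nnegrE ?invr_ge0 ?subr_ge0 ?p1 //.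
by move: p2; lra.
Qed.

Let pow_le a b r k x : (a <= d)%N -> (b <= M)%N -> 0 <= r -> r <= 1 -> (n <= k.*2)%N ->
  x <= q * r * n%:R / 2 ->
  (1 - p ^+ a * (1 - p) ^+ b * r) ^+ k <= expR (- x).
Proof.
move=> ad bM r0 r1 nk xle.
have qr1 : p ^+ a * (1 - p) ^+ b * r <= 1.
  have pa : p ^+ a <= 1 by rewrite exprn_ile1 // ltW.
  have pb : (1 - p) ^+ b <= 1 by rewrite exprn_ile1 ?subr_ge0 //; move: p0; lra.
  have pa0 : 0 <= p ^+ a by rewrite exprn_ge0 // ltW.
  have pb0 : 0 <= (1 - p) ^+ b by rewrite exprn_ge0 // subr_ge0.
  apply: mulr_ile1 => //; first by rewrite mulr_ge0.
  exact: mulr_ile1.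
have qr : q * r <= p ^+ a * (1 - p) ^+ b * r by rewrite ler_wpM2r ?q_le.
have qr0 : 0 <= q * r by rewrite mulr_ge0 // ltW.
apply: le_trans (_ : (1 - q * r) ^+ k <= _).
  by apply: lerXn2r; rewrite ?nnegrE; lra.
apply: le_trans (onem_expr_le _ _) _; first by rewrite qr0; lra.
rewrite ler_expR mulNr lerN2; apply: le_trans xle _.
rewrite -mulrA; apply: ler_wpM2l => //.
have : n%:R <= k.*2%:R :> R by rewrite ler_nat.
rewrite -muln2 natrM; lra.
Qed.

Lemma one_hit_rate a b s : (a <= d)%N -> (b <= M)%N -> (0 < s <= s0)%N ->
  (1 - p ^+ a * (1 - p) ^+ b * (1 - (1 - p) ^+ s)) ^+ (n - (a + b + s)) <= y ^+ s.
Proof.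
move=> ad bM /andP[s1 ss]; rewrite /y -expRM_natr mulNr.
have sp : 0 <= s%:R * p by rewrite mulr_ge0 // ltW.
have sp2 : s%:R * p <= 2.
  by apply: le_trans s0p2; rewrite ler_wpM2r ?ler_nat // ltW.
have r3 : s%:R * p / 3 <= 1 - (1 - p) ^+ s.
  apply: le_trans (some_neighbor_ge s p0 p1).
  by rewrite ler_wpM2l // lef_pV2 ?posrE; lra.
have ps0 : 0 <= (1 - p) ^+ s by rewrite exprn_ge0 ?subr_ge0.
apply: pow_le => //; [lra|lra|move: nbig; lia|].
have qn : 0 <= q * n%:R by rewrite mulr_ge0 // ltW.
have := ler_wpM2l qn r3; have := mulr_ge0 qn sp; lra.
Qed.

Lemma two_hits_rate a b : (a <= d)%N -> (b <= M)%N ->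
  (1 - p ^+ a * (1 - p) ^+ b * (1 - (1 - p) ^+ s0) ^+ 2) ^+ (n - (a + b + (s0 + s0)))
  <= y ^+ (s0 + s0).
Proof.
move=> ad bM; rewrite /y -expRM_natr mulNr.
have r2 : 2^-1 <= 1 - (1 - p) ^+ s0.
  apply: le_trans (some_neighbor_ge s0 p0 p1).
  by rewrite ler_pdivlMr; move: s0p; lra.
have ps0 : 0 <= (1 - p) ^+ s0 by rewrite exprn_ge0 ?subr_ge0.
have r4 : 4^-1 <= (1 - (1 - p) ^+ s0) ^+ 2 by rewrite expr2; nra.
apply: pow_le => //; [lra|by rewrite expr2; nra|move: nbig; lia|].
have qn : 0 <= q * n%:R by rewrite mulr_ge0 // ltW.
have h1 := ler_wpM2l qn r4; have h2 := ler_wpM2l qn s0p2.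
rewrite natrD; lra.
Qed.
End Rate.

Lemma expr1D_le (y : R) n : 0 <= y -> n%:R * y <= 2^-1 -> (1 + y) ^+ n <= 1 + 2 * (n%:R * y).
Proof.
move=> y0; elim: n => [|n IH] ny; first by rewrite expr0 mul0r mulr0 addr0.
have ny' : n%:R * y <= 2^-1 by move: ny; rewrite -natr1; lra.
have ny0 : 0 <= n%:R * y by rewrite mulr_ge0.
rewrite exprSr; apply: le_trans (ler_wpM2r _ (IH ny')) _; first lra.
rewrite -natr1; nra.
Qed.

End Estimates.

(** * From hitting properties to the limit *)

Lemma powR_nat_large (R : realType) (a L : R) : 0 < a -> 0 <= L ->
  exists N, forall n, (N <= n)%N -> L <= n%:R `^ a.
Proof.
move=> a0 L0; exists (Num.trunc (L `^ a^-1)).+1 => n Nn.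
have -> : L = (L `^ a^-1) `^ a by rewrite -powRrM mulVf ?gt_eqF // powRr1.
apply: ge0_ler_powR; rewrite ?nnegrE ?powR_ge0 ?(ltW a0) //.
apply: ltW; apply: lt_le_trans (_ : (Num.trunc (L `^ a^-1)).+1%:R <= _).
  by case/andP: (truncn_itv (powR_ge0 L a^-1)).
by rewrite ler_nat.
Qed.

Lemma coincidence_of_hits (R : realType) n d M s0 (E : {set {set 'I_n}}) :
  (3 * d + 8 <= M)%N -> is_graph E -> (0 < s0)%N -> (M < n)%N ->
  one_hit d M s0 E && two_hits d M s0 E -> has_Z2_coincidence R E d.+1.
Proof.
move=> hM Eg s00 Mn /andP[h1 h2].
have [c hc] := @antipodal_chains_exist _ (adj E) (adjC E) (adj_irr Eg) d M
  (hits_extension s00 Mn h1) (hits_connection Eg s00 h1 h2) hM.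
exact: coincidence_of_antipodal_chains hc.
Qed.

(** The failure bound is of order [n ^ (d + M)] times [n * y]. Here [y] is [expR (- c * n ^ eps)]
    because [p ^ (d + 1) * n = n ^ eps], and [eps > 0] is the hypothesis on [alpha]. *)
Lemma gnp_coincidence_rate (R : realType) d (alpha : R) :
  0 < alpha -> alpha * d.+1%:R < 1 ->
  exists C : R, exists N, forall n, (N <= n)%N ->
    1 - C / n%:R <= gnp_prob ((n%:R : R) `^ (- alpha))
      (fun E : {set {set 'I_n}} => has_Z2_coincidence R E d.+1) <= 1.
Proof.
move=> al0 ald; have [M hM] : exists M, (3 * d + 8 <= M)%N by exists (3 * d + 8)%N.
(* The choices of [A] and [B] cost [n ^ (d + M)]; one more power of [n] leaves [C / n]. *)
pose K := (d + M).+1.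
pose eps := 1 - alpha * d.+1%:R.
have eps0 : 0 < eps by rewrite subr_gt0.
have al1 : alpha < 1.
  by apply: le_lt_trans ald; rewrite ler_peMr ?ler1n // ltW.
(* Chosen so that [n ^ eps] to the power [m + 1] is at least [n ^ (K + 1)], which gives
   [y <= C0 / n ^ (K + 1)]. *)
pose m := Num.trunc (K.+1%:R / eps).
have mK : K.+1%:R <= eps * m.+1%:R.
  rewrite mulrC -ler_pdivrMr //; apply: ltW.
  by case/andP: (@truncn_itv _ (K.+1%:R / eps) (divr_ge0 (ler0n _ _) (ltW eps0))).
pose c : R := 2^-1 ^+ M / 32.
have c0 : 0 < c by rewrite divr_gt0 ?exprn_gt0 ?invr_gt0.
pose C0 := (m.+1%:R / c) ^+ m.+1.
have C00 : 0 <= C0 by rewrite exprn_ge0 // divr_ge0 // ltW.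
have [N1 hN1] := powR_nat_large al0 (ler0n R 2).
have [N2 hN2] : exists N, forall n, (N <= n)%N -> (16 : R) <= n%:R `^ (1 - alpha).
  by apply: powR_nat_large; rewrite ?subr_gt0.
exists (16 * 2 ^+ (d + M) * C0).
(* [N1] ensures [p <= 1/2]; [N2] and [4 * (d + M)] leave at least [n / 2] vertices outside the fixed
   sets; [2 * C0] yields [n * y <= 1/2]. *)
exists (maxn (maxn N1 N2) (maxn (4 * (d + M)).+1 (Num.trunc (2 * C0)).+1)) => n.
rewrite !geq_max => /andP[/andP[/hN1 nal /hN2 nal1] /andP[ndM nC]].
have n0 : (0 < n)%N by lia.
have n0R : 0 < n%:R :> R by rewrite ltr0n.
have n1R : 1 <= n%:R :> R by rewrite ler1n.
have Mn : (M < n)%N by lia.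
have C0n : 2 * C0 <= n%:R.
  apply: ltW; apply: lt_le_trans (_ : (Num.trunc (2 * C0)).+1%:R <= _); last by rewrite ler_nat.
  by case/andP: (@truncn_itv _ (2 * C0) (mulr_ge0 (ler0n _ 2) C00)).
set p := n%:R `^ (- alpha).
have p0 : 0 < p by rewrite powR_gt0.
have pV : p^-1 = n%:R `^ alpha by rewrite /p powRN invrK.
have p2 : p <= 2^-1 by rewrite -[p]invrK pV lef_pV2 ?posrE ?powR_gt0.
have p1 : p <= 1 by lra.
(* The least integer above [1 / p]: sets of this size are hit by a given vertex with probability
   bounded below, while [s0 * p] stays at most 2. *)
pose s0 := (Num.trunc p^-1).+1.
have [s0l s0r] : p^-1 < s0%:R /\ s0%:R <= p^-1 + 1.
  have pV0 : 0 <= p^-1 by rewrite invr_ge0 ltW.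
  have /andP[h1 h2] := truncn_itv pV0.
  by split=> //; rewrite /s0 -natr1 lerD2r.
have s0p : 1 <= s0%:R * p by rewrite -ler_pdivrMr // mul1r ltW.
have s0p2 : s0%:R * p <= 2.
  apply: le_trans (ler_wpM2r (ltW p0) s0r) _.
  by rewrite mulrDl mulVf ?gt_eqF // mul1r; lra.
have nE : n%:R = n%:R `^ alpha * n%:R `^ (1 - alpha).
  by rewrite -powRD ?subrKC ?powRr1 // oner_eq0.
have nbig : ((d + M + (s0 + s0)).*2 <= n)%N.
  rewrite -(ler_nat R) -muln2 natrM !natrD.
  have h4 : 4 * (d%:R + M%:R) <= n%:R :> R.
    by rewrite -natrD -natrM ler_nat ltnW.
  have h5 : s0%:R <= 2 * n%:R `^ alpha by rewrite -pV -ler_pdivrMr ?invr_gt0 // invrK; lra.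
  have h6 : 16 * n%:R `^ alpha <= n%:R.
    by rewrite {2}nE mulrC ler_wpM2l // powR_ge0.
  lra.
set y := expR (- (p ^+ d * 2^-1 ^+ M * p * n%:R / 32)).
have xE : p ^+ d * 2^-1 ^+ M * p * n%:R / 32 = c * n%:R `^ eps.
  have -> : n%:R `^ eps = p ^+ d.+1 * n%:R.
    rewrite /p -powR_mulrn ?powR_ge0 // -powRrM -[X in _ * X](powRr1 (ltW n0R)).
    rewrite -powRD; last by apply/implyP => _; rewrite gt_eqF.
    by rewrite /eps addrC mulNr.
  rewrite /c exprS; ring.
have y_le : y <= C0 / n%:R ^+ K.+1.
  rewrite /y xE; apply: le_trans (expRN_le m (mulr_gt0 c0 (powR_gt0 eps n0R))) _.
  rewrite invfM mulrA exprMn; apply: ler_wpM2l => //.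
  rewrite exprVn lef_pV2 ?posrE ?exprn_gt0 ?powR_gt0 //.
  rewrite -!powR_mulrn ?powR_ge0 // -powRrM; exact: ler_powR.
have y0 : 0 <= y by rewrite expR_ge0.
have nK : n%:R * y <= C0 / n%:R ^+ K.
  by rewrite -ler_pdivlMl // mulrCA -invfM -exprS.
have ny : n%:R * y <= 2^-1.
  apply: le_trans nK _; apply: le_trans (_ : C0 / n%:R <= _); last by rewrite ler_pdivrMr //; lra.
  by rewrite ler_wpM2l // lef_pV2 ?posrE ?exprn_gt0 // ler_eXnr.
have ny0 : 0 <= n%:R * y by rewrite mulr_ge0 // ltW.
apply/andP; split; last by apply: gnp_prob_le1 => //; apply: ltW.
pose Q : pred {set {set 'I_n}} := fun E => one_hit d M s0 E && two_hits d M s0 E.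
apply: le_trans (_ : gnp_prob p (fun E => Q E) <= _); last first.
  by apply: le_gnp_prob => // [|E Eg]; [exact: ltW|exact: (coincidence_of_hits hM)].
rewrite (gnp_prob_expect p) lerBlDr -lerBlDl.
rewrite -[X in X - _](expectC p (all_edges n)) -expectB.
(* With this choice [(1 + t) ^+ n <= 2], so the sets with at most [k] elements number at most
   [2 * (2 * n) ^ k]. *)
pose t : R := (2 * n%:R)^-1.
have t0 : 0 < t by rewrite invr_gt0 mulr_gt0.
have t1 : t <= 1 by rewrite invf_le1 ?mulr_gt0 //; lra.
have nt : n%:R * t = 2^-1 by rewrite /t invfM mulrCA mulfV ?gt_eqF // mulr1.
have tn : (1 + t) ^+ n <= 2.
  by apply: le_trans (expr1D_le (ltW t0) _) _; rewrite nt //; lra.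
have tn0 : 0 <= (1 + t) ^+ n by rewrite exprn_ge0 // addr_ge0 // ltW.
apply: le_trans (failure_bound (ltW p0) p1 y0 t0 t1 (ltn0Sn _)
  (one_hit_rate p0 p2 s0p s0p2 nbig) (two_hits_rate p0 p2 s0p s0p2 nbig)) _.
set sg := (1 + y) ^+ n - 1.
have sg_le : sg <= 2 * (n%:R * y) by have := expr1D_le y0 ny; rewrite /sg; lra.
have sg0 : 0 <= sg by rewrite subr_ge0 exprn_ege1 // lerDl.
have sg2 : sg + sg ^+ 2 <= 4 * (n%:R * y) by rewrite expr2; nra.
have tk k : t ^- k * (1 + t) ^+ n <= (2 * n%:R) ^+ k * 2.
  by rewrite /t exprVn invrK ler_wpM2l // exprn_ge0 // mulr_ge0.
have tk0 k : 0 <= t ^- k * (1 + t) ^+ n by rewrite mulr_ge0 // invr_ge0 exprn_ge0 // ltW.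
apply: le_trans (_ : (2 * n%:R) ^+ d * 2 * ((2 * n%:R) ^+ M * 2) * (4 * (n%:R * y)) <= _).
  apply: ler_pM => //; first by rewrite mulr_ge0.
    by rewrite addr_ge0 // exprn_ge0.
  exact: ler_pM.
have -> : (2 * n%:R) ^+ d * 2 * ((2 * n%:R) ^+ M * 2) * (4 * (n%:R * y)) =
    16 * 2 ^+ (d + M) * (n%:R ^+ K.-1 * (n%:R * y)).
  by rewrite /K /= !exprMn !exprD; ring.
rewrite -[leRHS]mulrA; apply: ler_wpM2l; first by rewrite mulr_ge0 // exprn_ge0.
apply: le_trans (ler_wpM2l _ nK) _; first by rewrite exprn_ge0.
rewrite mulrCA ler_wpM2l // exprS invfM mulrCA mulfV ?mulr1 //.
by rewrite expf_neq0 // gt_eqF.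
Qed.

Theorem theorem1p3 (R : realType) (d : nat) (alpha : R) :
  (1 <= d)%N -> (d.+1%:R)^-1 < alpha -> alpha < (d%:R)^-1 ->
  (fun n : nat => gnp_prob ((n%:R : R) `^ (- alpha))
                    (fun E : {set {set 'I_n}} => has_Z2_coincidence R E d))
    @ \oo --> (1 : R).
Proof.
(* From here on [d.+1] is the dimension of the theorem, in agreement with [gnp_coincidence_rate]. *)
case: d => // d _ al al1.
have al0 : 0 < alpha by apply: lt_trans al; rewrite invr_gt0.
have [|C [N hN]] := gnp_coincidence_rate (d := d) al0.
  by rewrite -ltr_pdivlMr // mul1r.
apply/cvgrPdist_le => e e0; near=> n.
have n0 : 0 < n%:R :> R by rewrite ltr0n; near: n; exact: nbhs_infty_gt.
have nN : (N <= n)%N by near: n; exact: nbhs_infty_ge.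
have /andP[h1 h2] := hN n nN.
rewrite ger0_norm ?subr_ge0 // lerBlDr -lerBlDl.
apply: le_trans h1; rewrite lerD2l lerN2 ler_pdivrMr // mulrC -ler_pdivrMr //.
near: n; exact: nbhs_infty_ger.
Unshelve. all: by end_near. Qed.
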